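(* Let $p\ge2$ and let $c:\mathbb{R}^d\to[0,\infty)$ be a convex function such that for some constants $\varepsilon>0$ and $K$, $$\varepsilon\,\mathbf{1}_{\{|x|<\varepsilon\}}|x|^2\le c(x)\le K\bigl(|x|^2+|x|^p\bigr)\qquad\text{for all }x\in\mathbb{R}^d .$$ Moreover, assume that the convex conjugate $c^*$ is strictly convex and that there are constants $1<a\le A<\infty$ such that $c^*(sx)\le s^{\frac{A}{A-1}}c^*(x)$ for all $x\in\mathbb{R}^d$, $s\in[0,1]$, and $c^*(sx)\le s^{\frac{a}{a-1}}c^*(x)$ for all $x\in\mathbb{R}^d$, $s>1$. Let $\{\mu_\theta\}_{\theta\in\Theta}$ be a family of Borel probability measures on $\mathbb{R}^d$ which satisfy the convex modified log-Sobolev inequality (for $c^*$) with uniformly bounded constants: $$C_\Theta:=\sup_{\theta\in\Theta}C_{\mathrm{mLS}}^{\mathrm{conv}}(\mu_\theta)<\infty .$$ Suppose moreover that $$D_\Theta:=\sup_{\theta,\theta'\in\Theta}\overline{\mathcal{T}}_{2,p}(\mu_\theta|\mu_{\theta'})<\infty$$ and that $\int_{\mathbb{R}^d}\exp(s|x|)\,d\mu_\theta(x)<\infty$ for all $\theta\in\Theta$ and $s>0$. Then the mixture $\mu_{\mathrm{mix}}$ of the family with respect to a mixing probability measure $m$ on $\Theta$ satisfies the convex modified log-Sobolev inequality (for $c^*$). Moreover, $C_{\mathrm{mLS}}^{\mathrm{conv}}(\mu_{\mathrm{mix}})$ can be bounded in terms of $C_\Theta$, $D_\Theta$, $a$, $A$,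 and $p$.
   Context: Mixture: $(\Theta,\mathfrak{M},m)$ is a probability space, for every Borel set $A\subset\mathbb{R}^d$ the map $\theta\mapsto\mu_\theta(A)$ is measurable, and $\mu_{\mathrm{mix}}(A):=\int_\Theta \mu_\theta(A)\,dm(\theta)$ for Borel $A\subset\mathbb{R}^d$. $|\cdot|$ is the Euclidean norm. Convex conjugate: $c^*(y):=\sup_{x\in\mathbb{R}^d}\{\langle x,y\rangle-c(x)\}$. $\mathrm{Ent}_\mu(g):=\int g\log g\,d\mu-\int g\,d\mu\,\log(\int g\,d\mu)$ for $g\ge0$. A probability measure $\mu$ on $\mathbb{R}^d$ satisfies the convex modified log-Sobolev inequality (for $c^*$) with constant $C\in(0,\infty)$ if $$\mathrm{Ent}_\mu(e^f)\le C\int_{\mathbb{R}^d}c^*(\nabla f)\,e^f\,d\mu$$ for all convex, Lipschitz, $C^1$, and bounded from below functions $f:\mathbb{R}^d\to\mathbb{R}$. $C_{\mathrm{mLS}}^{\mathrm{conv}}(\mu)$ is the best such constant (infimum; $+\infty$ if there is none). $\overline{\mathcal{T}}_{2,p}(\mu_2|\mu_1):=\inf_\pi\int_{\mathbb{R}^d}w\bigl(x-\int_{\mathbb{R}^d}y\,p_x(dy)\bigr)\mu_1(dx)$ with $w(z)=|z|^2+|z|^p$, for probability measures $\mu_1,\mu_2$ on $\mathbb{R}^d$, $\mu_2$ with finite first moment, where the infimum is over all couplings $\pi$ of $\mu_1$ and $\mu_2$, and $p_x$ is defined ($\mu_1$-a.s.) by $\pi(dx\,dy)=p_x(dy)\m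u_1(dx)$.
   Formalization: The bound on the constant of the mixture may also depend on K; without this it fails: for d=1, p=a=A=2, c(x)=kx² and the half-half mixture of the Dirac masses at 0 and 1, C_Θ=0 and D_Θ=2 for all k, but the constant of the mixture grows like k. *)

(* Defs.v *)
From HB Require Import structures.
From mathcomp Require Export all_boot all_order all_algebra.
From mathcomp Require Export all_classical all_reals all_analysis.
Import Order.TTheory GRing.Theory Num.Theory.
Import numFieldNormedType.Exports.

Set Implicit Arguments.
Unset Strict Implicit.
Unset Printing Implicit Defensive.

Local Open Scope classical_set_scope.
Local Open Scope ring_scope.

(* 'rV[R]_d with its Borel sigma-algebra *)
Definition borel_rV (R : realType) (d : nat) :=
  g_sigma_algebraType (@open 'rV[R]_d).

Section euclidean.
Context {R : realType} {d : nat}.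
Implicit Types (x y : 'rV[R]_d) (f : 'rV[R]_d -> R).

Definition dotp x y : R := \sum_(i < d) x ord0 i * y ord0 i.

(* The library's `|x| is the sup norm on row vectors; it defines the same
   topology and the same Lipschitz functions. *)
Definition enorm x : R := Num.sqrt (dotp x x).

Definition gradient f x : 'rV[R]_d := \row_i 'D_(delta_mx ord0 i) f x.

Definition C1 f := (forall x, differentiable f x) /\ continuous (gradient f).

Definition bounded_below f := exists b : R, forall x, b <= f x.

Definition conjugate (c : 'rV[R]_d -> R) y : \bar R :=
  ereal_sup (range (fun x => (dotp x y - c x)%:E)).

Definition strictly_convex (g : 'rV[R]_d -> \bar R) :=
  forall x y (t : R), x != y -> 0 < t < 1 ->
    (g (t *: x + (1 - t) *: y)%R < t%:E * g x + (1 - t)%:E * g y)%E.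

Definition wcost (p : R) x : R := enorm x ^+ 2 + enorm x `^ p.

End euclidean.

Section entropy.
Local Open Scope ereal_scope.
Context {dT} {T : measurableType dT} {R : realType}.

(* The dual subtraction takes +oo - +oo to +oo, so Ent is +oo when g is not
   integrable. *)
Definition Ent (mu : {measure set T -> \bar R}) (g : T -> R) : \bar R :=
  ((\int[mu]_x (g x * ln (g x))%:E)%E
   - ((\int[mu]_x (g x)%:E) * lne (\int[mu]_x (g x)%:E))%E)%dE.

End entropy.

Section convex_mLS.
Local Open Scope ereal_scope.
Context {R : realType} {d : nat}.
Implicit Types (c : 'rV[R]_d -> R) (mu : {measure set (borel_rV R d) -> \bar R}).

Definition conv_mLS c mu (C : R) :=
  forall f : 'rV[R]_d -> R,
    convex_function setT f -> lipschitz f -> C1 f -> bounded_below f ->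
    Ent mu (fun x => expR (f x)) <=
    C%:E * \int[mu]_x (conjugate c (gradient f x) * (expR (f x))%:E).

Definition conv_mLS_const c mu : \bar R :=
  ereal_inf [set C%:E | C in [set C : R | (0 < C)%R /\ conv_mLS c mu C]].

End convex_mLS.

Section weak_transport.
Local Open Scope ereal_scope.
Context {R : realType} {d : nat}.
Notation E := (borel_rV R d).
Implicit Types mu : {measure set E -> \bar R}.

Definition coupling mu1 mu2 (pi : probability (E * E)%type R) :=
  forall A : set E, measurable A ->
    pi (A `*` setT) = mu1 A /\ pi (setT `*` A) = mu2 A.

Definition disintegration mu1 (pi : probability (E * E)%type R)
    (k : R.-pker E ~> E) :=
  forall A B : set E, measurable A -> measurable B ->
    pi (A `*` B) = \int[mu1]_(x in A) k x B.

Definition barycenter mu : 'rV[R]_d := (\row_i \int[mu]_y (y : 'rV[R]_d) ord0 i)%R.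

(* weak_transport p mu2 mu1 is the cost written T(mu2 | mu1), where the kernel
   starts from mu1. It is meant for mu2 with a finite first moment, so that
   barycenter (k x) is a genuine integral for mu1-almost every x. *)
Definition weak_transport (p : R) mu2 mu1 : \bar R :=
  ereal_inf [set v | exists (pi : probability (E * E)%type R)
                            (k : R.-pker E ~> E),
    [/\ coupling mu1 mu2 pi, disintegration mu1 pi k &
        v = \int[mu1]_x (wcost p ((x : 'rV[R]_d) - barycenter (k x)))%:E]].

End weak_transport.

Section mixture.
Local Open Scope ereal_scope.
Context {dT dE} {T : measurableType dT} {E : measurableType dE} {R : realType}.
Variables (m : probability T R) (mu : R.-pker T ~> E).

Definition mixture (A : set E) : \bar R := \int[m]_t mu t A.

Let mixture0 : mixture set0 = 0.
Proof.
by rewrite /mixture (eq_integral (cst 0)) ?integral0// => t _; rewrite measure0.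
Qed.

Let mixture_ge0 A : 0 <= mixture A. Proof. exact: integral_ge0. Qed.

Let mixture_sigma_additive : semi_sigma_additive mixture.
Proof.
move=> U mU tU mUU; rewrite [X in _ --> X](_ : _ =
  \int[m]_t (\sum_(n <oo) mu t (U n))); last first.
  apply: eq_integral => t _.
  by apply/esym/cvg_lim => //; exact/measure_semi_sigma_additive.
apply/cvg_closeP; split.
  by apply: is_cvg_nneseries => n _ _; exact: integral_ge0.
rewrite closeE// integral_nneseries// => n.
exact: measurable_kernel.
Qed.

HB.instance Definition _ := isMeasure.Build _ _ R
  mixture mixture0 mixture_ge0 mixture_sigma_additive.

Let mixture_setT : mixture setT = 1.
Proof.
rewrite /mixture (eq_integral (cst 1)) => [|t _]; last exact: prob_kernel.
by rewrite integral_cst// mul1e; exact: probability_setT.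
Qed.

HB.instance Definition _ := Measure_isProbability.Build _ _ R
  mixture mixture_setT.

End mixture.

(* Main.v *)
(* Write F(t) for the integral of e^f against mu_t and J(t) for that of
   c^*(grad f) e^f. The entropy of e^f under the mixture is the average of its
   entropies under the mu_t plus the entropy of F under m, and the latter is at
   most half the double integral of (F(t) - F(t')) (ln F(t) - ln F(t')). So it
   suffices to bound this product by a multiple of J(t) when F(t) >= F(t').
   Weak transport from mu_t to mu_t' and Jensen's inequality compare, for convex
   g, the means of g at t and t', up to integrals under mu_t of grad g paired
   with the displacement z = x - barycenter, of which only w(z) is controlled.

   If j = J(t) / F(t) is large: apply this to the convex minorant g of f made of
   the tangents of f at points where c^*(grad f) <= 4 j. Then c^*(grad g) <= 4 j
   everywhere, hence ln of the integral of e^g exceeds the mean of g by O(j)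
   under mu_t (Herbst), while g is close to f on most of the mass of e^f. This
   gives ln F(t) - ln F(t') = O(1 + j), without Hamilton-Jacobi semigroups.

   If j is small: apply it, after normalizing F(t) = 1, to max(e^(f/2), 1/2).
   The truncation keeps the gradient weight y = e^(f/2)/2 away from 0, so that
   Young's inequality at scale eta = sqrt j / (4 y) <= 1 only costs
   eta^2 w(z), and one gets F(t') >= 1 - O(sqrt j). *)
From HB Require Import structures.
Require Import Defs.
From mathcomp Require Import ring lra measurable_realfun.
Import Order.TTheory GRing.Theory Num.Theory.
Import numFieldNormedType.Exports.

Set Implicit Arguments.
Unset Strict Implicit.
Unset Printing Implicit Defensive.

Local Open Scope classical_set_scope.
Local Open Scope ring_scope.

(** * Euclidean geometry, gradients and tangents of convex functions *)

Section Euclidean.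
Context {R : realType} {d : nat}.
Implicit Types (x y z v : 'rV[R]_d) (f : 'rV[R]_d -> R).

Lemma dotpC x y : dotp x y = dotp y x.
Proof. by apply: eq_bigr => i _; rewrite mulrC. Qed.

Lemma dotpDl x y z : dotp (x + y) z = dotp x z + dotp y z.
Proof.
by rewrite /dotp -big_split/=; apply: eq_bigr => i _; rewrite !mxE mulrDl.
Qed.

Lemma dotpZl t x y : dotp (t *: x) y = t * dotp x y.
Proof. by rewrite /dotp mulr_sumr; apply: eq_bigr => i _; rewrite !mxE mulrA. Qed.

Lemma dotpNl x y : dotp (- x) y = - dotp x y.
Proof. by rewrite -scaleN1r dotpZl mulN1r. Qed.

Lemma dotpDr x y z : dotp x (y + z) = dotp x y + dotp x z.
Proof. by rewrite dotpC dotpDl !(dotpC _ x). Qed.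

Lemma dotpZr t x y : dotp x (t *: y) = t * dotp x y.
Proof. by rewrite dotpC dotpZl dotpC. Qed.

Lemma dotpNr x y : dotp x (- y) = - dotp x y.
Proof. by rewrite dotpC dotpNl dotpC. Qed.

Lemma dotp_suml (I : Type) (r : seq I) (P : pred I) (F : I -> 'rV[R]_d) y :
  dotp (\sum_(i <- r | P i) F i) y = \sum_(i <- r | P i) dotp (F i) y.
Proof.
rewrite (big_morph (fun x => dotp x y) (fun a b => dotpDl a b y) (_ : _ = 0))//.
by rewrite -(scale0r 0) dotpZl mul0r.
Qed.

Lemma dotp_ge0 x : 0 <= dotp x x.
Proof. by apply: sumr_ge0 => i _; rewrite -expr2 sqr_ge0. Qed.

Lemma enorm_ge0 x : 0 <= enorm x.
Proof. exact: sqrtr_ge0. Qed.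

Lemma sqr_enorm x : enorm x ^+ 2 = dotp x x.
Proof. by rewrite sqr_sqrtr// dotp_ge0. Qed.

Lemma enormZ t x : enorm (t *: x) = `|t| * enorm x.
Proof.
by rewrite /enorm dotpZl dotpZr mulrA -expr2 sqrtrM ?sqr_ge0// sqrtr_sqr.
Qed.

Lemma dotp_le_enorm x y : dotp x y <= enorm x * enorm y.
Proof.
have key : dotp x y ^+ 2 <= dotp x x * dotp y y.
  (* The squared norm of this vector is [dotp y y] times the Cauchy-Schwarz deficit. *)
  have := dotp_ge0 (dotp y y *: x - dotp x y *: y).
  rewrite !dotpDl !dotpDr !dotpNl !dotpNr !dotpZl !dotpZr (dotpC y x) => H.
  have [y0|y0] := eqVneq (dotp y y) 0.
    have y00 : y = 0.
      apply/rowP => i; rewrite mxE; apply/eqP; rewrite -sqrf_eq0 expr2.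
      move/eqP: y0; rewrite psumr_eq0; last by move=> j _; rewrite -expr2 sqr_ge0.
      by move/allP => /(_ i); rewrite mem_index_enum => /(_ isT).
    by rewrite y00 -(scale0r 0) !dotpZr !mul0r mulr0 expr0n.
  have yp : 0 < dotp y y by rewrite lt_neqAle eq_sym y0 dotp_ge0.
  have : 0 <= dotp y y * (dotp x x * dotp y y - dotp x y ^+ 2) by nra.
  by rewrite pmulr_rge0// subr_ge0.
apply: le_trans (ler_norm _) _.
rewrite -(ler_pXn2r (n := 2))// ?nnegrE ?mulr_ge0 ?enorm_ge0//.
by rewrite real_normK ?num_real// exprMn !sqr_enorm.
Qed.

Lemma coord_le_enorm x i : `|x ord0 i| <= enorm x.
Proof.
rewrite -(ler_pXn2r (n := 2))// ?nnegrE ?enorm_ge0//.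
rewrite real_normK ?num_real// sqr_enorm /dotp (bigD1 i)//= expr2 lerDl.
by apply: sumr_ge0 => j _; rewrite -expr2 sqr_ge0.
Qed.

Lemma norm_le_enorm x : `|x| <= enorm x.
Proof.
rewrite [leLHS]mx_normrE; apply: bigmax_le; first exact: enorm_ge0.
by move=> [i j] _ /=; rewrite (ord1 i) coord_le_enorm.
Qed.

Lemma enorm_le_sum x : enorm x <= \sum_i `|x ord0 i|.
Proof.
have h : forall s : seq 'I_d, \sum_(i <- s) x ord0 i * x ord0 i <=
   (\sum_(i <- s) `|x ord0 i|) ^+ 2.
  elim=> [|i s IH]; first by rewrite !big_nil expr0n.
  rewrite !big_cons.
  have a0 : 0 <= \sum_(j <- s) `|x ord0 j| by apply: sumr_ge0.
  have := normr_ge0 (x ord0 i).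
  rewrite -expr2 -(real_normK (num_real (x ord0 i))).
  nra.
rewrite -(ler_pXn2r (n := 2))// ?nnegrE ?enorm_ge0// ?sumr_ge0//.
by rewrite sqr_enorm h.
Qed.

Lemma dotp_continuous x : continuous (dotp x).
Proof.
apply: continuous_big => [|i _ v]; first exact: add_continuous.
by apply: continuousM; [exact: cst_continuous|exact: coord_continuous].
Qed.

Lemma enorm_continuous : continuous (@enorm R d).
Proof.
move=> x; apply: (@continuous_comp _ _ _ (fun x => dotp x x) (@Num.sqrt R)).
  apply: continuous_big => [|i _ y]; first exact: add_continuous.
  by apply: continuousM; exact: coord_continuous.
exact: sqrt_continuous.
Qed.

Lemma gradient_diff f x v : differentiable f x -> dotp (gradient f x) v = 'D_v f x.
Proof.
move=> df; rewrite deriveE// {2}(row_sum_delta v) linear_sum/=.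
by apply: eq_bigr => i _; rewrite linearZ/= mxE deriveE// mulrC.
Qed.

Lemma convex_function_line f : convex_function setT f -> forall x y (t : R),
  0 <= t <= 1 -> f (x + t *: (y - x)) <= f x + t * (f y - f x).
Proof.
move=> cf x y t /andP[t0 t1].
have H : f (t *: y + (1 - t) *: x) <= t * f y + (1 - t) * f x.
  by have := cf (Itv01 t0 t1) y x; rewrite !inE => /(_ I I).
have -> : x + t *: (y - x) = t *: y + (1 - t) *: x.
  by rewrite scalerBr scalerBl scale1r addrCA.
apply: le_trans H _; lra.
Qed.

(** By convexity the difference quotients along [y - x] with step in (0, 1] are at most [f y - f x];
    the directional derivative is their limit from the right. *)
Lemma convex_tangent f : convex_function setT f -> (forall x, differentiable f x) ->
  forall x y, f x + dotp (gradient f x) (y - x) <= f y.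
Proof.
move=> cf df x y; rewrite gradient_diff// addrC -lerBrDr.
have /cvg_dnbhs_at_right dv :
    (fun h : R => h^-1 *: ((f \o shift x) (h *: (y - x)) - f x)) @ (0 : R)^' -->
    'D_(y - x) f x by exact: diff_derivable.
rewrite -(cvg_lim _ dv)//; apply: limr_le; first by apply/cvg_ex; eexists; exact: dv.
near=> h.
have h0 : 0 < h by near: h; exact: nbhs_right_gt.
have h1 : h <= 1 by near: h; apply: nbhs_right_le.
have := convex_function_line cf x y (t := h).
rewrite (ltW h0) h1 => /(_ isT).
rewrite /GRing.scale/= [h *: _ + x]addrC => H.
by rewrite ler_pdivrMl//; lra.
Unshelve. all: by end_near.
Qed.

End Euclidean.

(** * The convex conjugate: finiteness, convexity, lower semicontinuity *)

Definition conjr {R : realType} {d : nat} (c : 'rV[R]_d -> R) v : R :=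
  fine (conjugate c v).

Section Conjugate.
Context {R : realType} {d : nat}.
Variable c : 'rV[R]_d -> R.
Implicit Types (x y z v : 'rV[R]_d).

Lemma conjugate_le v (r : R) :
  (conjugate c v <= r%:E)%E <-> forall x, dotp x v - c x <= r.
Proof.
split=> [h x|h].
  by rewrite -lee_fin; apply: le_trans h; apply: ereal_sup_ubound; exists x.
by apply: ge_ereal_sup => _ [x _ <-]; rewrite lee_fin.
Qed.

Lemma conjugate_ge v x : ((dotp x v - c x)%:E <= conjugate c v)%E.
Proof. by apply: ereal_sup_ubound; exists x. Qed.

Section finite.
Hypothesis fin : forall v, conjugate c v \is a fin_num.

Lemma conjrE v : conjugate c v = (conjr c v)%:E.
Proof. by rewrite fineK. Qed.

Lemma conjr_le v (r : R) : conjr c v <= r <-> forall x, dotp x v - c x <= r.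
Proof. by rewrite -conjugate_le conjrE lee_fin. Qed.

Lemma fenchel_young x v : dotp x v <= conjr c v + c x.
Proof. by have := conjugate_ge v x; rewrite conjrE lee_fin lerBlDr. Qed.

Lemma conjr_ge0 : c 0 = 0 -> forall v, 0 <= conjr c v.
Proof.
by move=> c0 v; have := fenchel_young 0 v; rewrite c0 addr0 -(scale0r v) dotpZl mul0r.
Qed.

(** Sublevel sets of a supremum of affine functions are convex. This later bounds the gradient of a
    smooth maximum by those of its pieces. *)
Lemma conjr_sum_le (I : Type) (s : seq I) (w : I -> R) (v : I -> 'rV[R]_d) r :
  (forall i, 0 <= w i) -> \sum_(i <- s) w i = 1 ->
  (forall i, conjr c (v i) <= r) ->
  conjr c (\sum_(i <- s) w i *: v i) <= r.
Proof.
move=> w0 w1 vr; apply/conjr_le => x.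
rewrite dotpC dotp_suml -[c x]mul1r -w1 mulr_suml -sumrB -[leRHS]mul1r -w1 mulr_suml.
apply: ler_sum => i _; rewrite dotpZl -mulrBr ler_wpM2l// dotpC.
by move: x; apply/(conjr_le (v i) r).1.
Qed.

Lemma conjugate_scale v (s t : R) : (conjugate c (s *: v)%R <= t%:E * conjugate c v)%E ->
  conjr c (s *: v) <= t * conjr c v.
Proof. by rewrite !conjrE -EFinM lee_fin. Qed.

(** Lower semicontinuity: a supremum of continuous functions exceeds [r] on a union of open sets. It
    yields both the measurability of [conjr c] along a continuous field and the closedness of its
    sublevel sets. *)
Lemma open_conjr_gt r : open [set v | r < conjr c v].
Proof.
have -> : [set v | r < conjr c v] = \bigcup_x [set v | r < dotp x v - c x].
  apply/seteqP; split => v /=.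
    move=> rv; apply: contrapT => h.
    suff : conjr c v <= r by rewrite leNgt rv.
    apply/conjr_le => x; rewrite leNgt; apply/negP => H.
    by apply: h; exists x.
  move=> [x _ /= h]; apply: lt_le_trans h _; rewrite lerBlDr.
  exact: fenchel_young.
apply: bigcup_open => x _.
apply: (@open_comp _ _ (fun v => dotp x v - c x) [set y | r < y]); last exact: open_gt.
move=> v _; apply: continuousB; last exact: cst_continuous.
exact: dotp_continuous.
Qed.

End finite.

(** The quadratic bound near 0 and convexity force linear growth of [c] away from 0, which bounds
    the conjugate on a small ball; the scaling for [s > 1] carries the bound to any ball. With
    nonnegativity this makes the conjugate finite, so that [conjr] represents it faithfully. *)
Lemma conjugate_fin (eps q : R) : (forall x, 0 <= c x) -> c 0 = 0 ->
  convex_function setT c -> 0 < eps ->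
  (forall x, eps * \1_[set z | enorm z < eps] x * enorm x ^+ 2 <= c x) ->
  (forall x (s : R), 1 < s -> (conjugate c (s *: x)%R <= (s `^ q)%:E * conjugate c x)%E) ->
  forall M, exists r : R, forall v, enorm v <= M -> (conjugate c v <= r%:E)%E.
Proof.
move=> cge c0 cc e0 ce sc M.
have lin x : eps <= enorm x -> eps ^+ 2 / 2 * enorm x <= c x.
  move=> ex; have x0 : 0 < enorm x by exact: lt_le_trans ex.
  (* Shrinks [x] to norm [eps / 2], strictly inside the ball where the indicator is 1. *)
  pose t := eps / 2 / enorm x.
  have t0 : 0 < t by rewrite !divr_gt0.
  have t1 : t <= 1 by rewrite ler_pdivrMr// mul1r; lra.
  have := convex_function_line cc 0 x (t := t).
  rewrite (ltW t0) t1 => /(_ isT); rewrite c0 add0r !subr0 add0r => H.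
  have tx : enorm (t *: x) = eps / 2.
    by rewrite enormZ gtr0_norm// divfK// gt_eqF.
  have := ce (t *: x); rewrite indicE mem_set/= ?tx; last by lra.
  rewrite mulr1 => H2.
  rewrite -(ler_pM2l t0); apply: le_trans H; apply: le_trans H2.
  have -> : t * (eps ^+ 2 / 2 * enorm x) = (t * enorm x) * (eps ^+ 2 / 2) by ring.
  rewrite /t divfK ?gt_eqF//; nra.
have small v : enorm v <= eps ^+ 2 / 2 -> (conjugate c v <= (eps ^+ 3 / 2)%:E)%E.
  move=> hv; apply/conjugate_le => x; rewrite lerBlDr.
  apply: le_trans (dotp_le_enorm _ _) _.
  have x0 := enorm_ge0 x; have v0 := enorm_ge0 v.
  have [xe|xe] := leP eps (enorm x).
    have := lin _ xe; have : 0 <= eps ^+ 3 by rewrite exprn_ge0// ltW.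
    nra.
  have : enorm x * enorm v <= eps * (eps ^+ 2 / 2) by apply: ler_pM => //; exact: ltW.
  by have := cge x; rewrite exprS; lra.
(* The second entry brings [s^-1 *: v] into the small ball; the first ensures [1 < s]. *)
pose s := Num.max 2 (2 * M / eps ^+ 2).
have s1 : 1 < s by rewrite lt_max; apply/orP; left; lra.
have s0 : 0 < s by lra.
exists (s `^ q * (eps ^+ 3 / 2)) => v vM.
have -> : v = s *: (s^-1 *: v) by rewrite scalerA divff ?gt_eqF// scale1r.
apply: le_trans (sc _ _ s1) _.
rewrite EFinM; apply: lee_wpmul2l; first by rewrite lee_fin powR_ge0.
apply: small; rewrite enormZ gtr0_norm ?invr_gt0//.
rewrite ler_pdivrMl//; apply: le_trans vM _.
have : 2 * M / eps ^+ 2 <= s by rewrite le_max lexx orbT.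
rewrite ler_pdivrMr ?exprn_gt0//; lra.
Qed.

Lemma conjugate_ge0 v : c 0 = 0 -> (0 <= conjugate c v)%E.
Proof.
move=> c0; apply: le_trans (conjugate_ge v 0).
by rewrite c0 subr0 -(scale0r v) dotpZl mul0r.
Qed.

End Conjugate.

(** * Borel measurability and integrability of functions of exponential growth *)

Section Borel.
Context {R : realType} {d : nat}.
Notation E := (borel_rV R d).

Lemma open_measurable_fun (f : E -> R) :
  (forall r, open ([set x | r < f x] : set 'rV[R]_d)) -> measurable_fun setT f.
Proof.
move=> fo; apply: (measurability _ (RGenOInfty.measurableE R)).
move=> _ [_ [r ->] <-]; rewrite setTI; apply: sub_sigma_algebra.
have -> : f @^-1` `]r, +oo[%classic = [set x | r < f x].
  by apply/seteqP; split => x /=; rewrite in_itv/= andbT.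
exact: fo.
Qed.

Lemma continuous_borel_measurable (f : 'rV[R]_d -> R) :
  continuous f -> measurable_fun setT (f : E -> R).
Proof.
move=> cf; apply: open_measurable_fun => r.
by apply: (@open_comp _ _ f [set y | r < y]) => [x _|]; [exact: cf|exact: open_gt].
Qed.

Lemma measurable_coord i : measurable_fun setT ((fun x : 'rV[R]_d => x ord0 i) : E -> R).
Proof. apply: continuous_borel_measurable; exact: coord_continuous. Qed.

Lemma measurable_enorm d' (T : measurableType d') (u : T -> 'rV[R]_d) :
  (forall i, measurable_fun setT (fun t => u t ord0 i)) ->
  measurable_fun setT (fun t => enorm (u t)).
Proof.
move=> mu; apply: (measurableT_comp (f := @Num.sqrt R)).
  by apply: continuous_measurable_fun; exact: sqrt_continuous.
by apply: measurable_sum => i; apply: measurable_funM.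
Qed.

Lemma measurable_wcost (p : R) d' (T : measurableType d') (u : T -> 'rV[R]_d) :
  (forall i, measurable_fun setT (fun t => u t ord0 i)) ->
  measurable_fun setT (fun t => wcost p (u t)).
Proof.
move=> mu; apply: measurable_funD.
  by apply: measurable_funX; exact: measurable_enorm.
by apply: (measurableT_comp (f := fun x => x `^ p)) => //; exact: measurable_enorm.
Qed.

Lemma measurable_conjr (c : 'rV[R]_d -> R) (u : 'rV[R]_d -> 'rV[R]_d) :
  (forall v, conjugate c v \is a fin_num) -> continuous u ->
  measurable_fun setT ((fun x => conjr c (u x)) : E -> R).
Proof.
move=> fin cu; apply: open_measurable_fun => r.
apply: (@open_comp _ _ u [set v | r < conjr c v]) => [x _|]; first exact: cu.
exact: open_conjr_gt.
Qed.

(* Domination by [M * expR (s * enorm x)] is stable under sums and products,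
   and guarantees integrability against every measure considered here. *)
Definition subexp (g : E -> R) := measurable_fun setT g /\
  exists M s : R, [/\ 0 <= M, 0 < s & forall x, `|g x| <= M * expR (s * enorm x)].

Definition sublinear (g : 'rV[R]_d -> R) :=
  exists a L : R, [/\ 0 <= a, 0 <= L & forall x, `|g x| <= a + L * enorm x].

Lemma subexp_cst (r : R) : subexp (fun=> r).
Proof.
split; first exact: measurable_cst.
exists `|r|, 1; split => // x; rewrite ler_peMr// mul1r.
by rewrite -expR0 ler_expR enorm_ge0.
Qed.

Lemma subexpD f g : subexp f -> subexp g -> subexp (fun x => f x + g x).
Proof.
move=> [mf [M [s [M0 s0 fM]]]] [mg [N [t [N0 t0 gN]]]].
split; first exact: measurable_funD.
exists (M + N), (s + t); split; [exact: addr_ge0|exact: addr_gt0|move=> x].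
apply: le_trans (ler_normD _ _) _; rewrite mulrDl.
apply: lerD.
  apply: le_trans (fM x) _; rewrite ler_wpM2l// ler_expR.
  by rewrite ler_wpM2r ?enorm_ge0// lerDl ltW.
apply: le_trans (gN x) _; rewrite ler_wpM2l// ler_expR.
by rewrite ler_wpM2r ?enorm_ge0// lerDr ltW.
Qed.

Lemma subexpM f g : subexp f -> subexp g -> subexp (fun x => f x * g x).
Proof.
move=> [mf [M [s [M0 s0 fM]]]] [mg [N [t [N0 t0 gN]]]].
split; first exact: measurable_funM.
exists (M * N), (s + t); split; [exact: mulr_ge0|exact: addr_gt0|move=> x].
by rewrite normrM mulrDl expRD mulrACA ler_pM.
Qed.

Lemma subexpZ r f : subexp f -> subexp (fun x => r * f x).
Proof. by apply: subexpM; exact: subexp_cst. Qed.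

Lemma subexpB f g : subexp f -> subexp g -> subexp (fun x => f x - g x).
Proof.
move=> hf hg; under eq_fun do rewrite -mulN1r.
by apply: subexpD => //; exact: subexpZ.
Qed.

Lemma subexp_sublinear (g : 'rV[R]_d -> R) : measurable_fun setT (g : E -> R) ->
  sublinear g -> subexp g.
Proof.
move=> mg [a [L [a0 L0 gL]]]; split => //.
exists (a + L), 1; split => //; first exact: addr_ge0.
move=> x; apply: le_trans (gL x) _; rewrite mulrDl mul1r.
have := expR_ge1Dx (enorm x); have := enorm_ge0 x => x0 x1.
by apply: lerD; [rewrite ler_peMr//|rewrite ler_wpM2l//]; lra.
Qed.

Lemma subexp_expR (g : 'rV[R]_d -> R) : measurable_fun setT (g : E -> R) ->
  sublinear g -> subexp (fun x => expR (g x)).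
Proof.
move=> mg [a [L [a0 L0 gL]]]; split; first exact: measurableT_comp.
exists (expR a), (L + 1); split; [exact: expR_ge0|lra|move=> x].
rewrite ger0_norm ?expR_ge0// -expRD ler_expR.
apply: le_trans (ler_norm _) _; apply: le_trans (gL x) _.
by rewrite lerD2l ler_wpM2r ?enorm_ge0//; lra.
Qed.

Lemma subexp_dominated (f g : E -> R) : measurable_fun setT f -> (forall x, `|f x| <= g x) ->
  subexp g -> subexp f.
Proof.
move=> mf fg [mg [M [s [M0 s0 gM]]]]; split => //; exists M, s; split => // x.
by apply: le_trans (fg x) _; apply: le_trans (ler_norm _) (gM x).
Qed.

Lemma subexp_enorm : subexp (@enorm R d).
Proof.
apply: subexp_sublinear; first by apply: measurable_enorm => i; exact: measurable_coord.
by exists 0, 1; split => // x; rewrite ger0_norm ?enorm_ge0// add0r mul1r.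
Qed.

Lemma subexp_bounded (f : E -> R) M : measurable_fun setT f ->
  (forall x, `|f x| <= M) -> subexp f.
Proof.
move=> mf fM; split => //; exists M, 1; split => // [|x].
  exact: le_trans (fM 0).
apply: le_trans (fM x) _; rewrite ler_peMr//; first exact: le_trans _ (fM x).
by rewrite mul1r -expR0 ler_expR enorm_ge0.
Qed.

Lemma sublinear_lipschitz (f : 'rV[R]_d -> R) : lipschitz f -> sublinear f.
Proof.
have pf : ProperFilter (globally (@setT 'rV[R]_d `*` @setT 'rV[R]_d)).
  exact: (@globally_properfilter _ _ (0, 0)).
move=> /ex_dom_bound [M HM].
exists (`|f 0|), `|M|; split => // x.
have := HM (x, 0) (conj I I); rewrite /= subr0 => H.
rewrite -[f x](subrK (f 0)); apply: le_trans (ler_normD _ _) _.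
rewrite addrC lerD2l; apply: le_trans H _.
apply: le_trans (ler_norm _) _; rewrite normrM.
by rewrite ler_wpM2l// normr_id norm_le_enorm.
Qed.

Lemma sublinearZ (f : 'rV[R]_d -> R) t : sublinear f -> sublinear (fun x => t * f x).
Proof.
move=> [a [L [a0 L0 fL]]]; exists (`|t| * a), (`|t| * L); split; rewrite ?mulr_ge0// => x.
by rewrite normrM -mulrA -mulrDr ler_wpM2l.
Qed.

Section integral.
Variable mu : {measure set E -> \bar R}.
Hypothesis mu1 : mu setT = 1%E.
Hypothesis muexp : forall s, 0 < s -> (\int[mu]_x (expR (s * enorm x))%:E < +oo)%E.

Lemma subexp_integrable f : subexp f -> mu.-integrable setT (EFin \o f).
Proof.
move=> [mf [M [s [M0 s0 fM]]]].
have me : measurable_fun setT (fun x : E => expR (s * enorm x)).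
  apply: measurableT_comp => //; apply: measurable_funM => //.
  exact: subexp_enorm.1.
apply: (@le_integrable _ _ _ mu _ measurableT _
  (EFin \o (fun x => M * expR (s * enorm x)))) => //.
- exact/measurable_EFinP.
- by move=> x _; rewrite /= lee_fin [leRHS]ger0_norm// mulr_ge0// expR_ge0.
apply/integrableP; split.
  by apply/measurable_EFinP; apply: measurable_funM.
under eq_integral => x _.
  rewrite /= ger0_norm ?mulr_ge0 ?expR_ge0// EFinM; over.
rewrite ge0_integralZl//.
- by rewrite lte_mul_pinfty// muexp.
- exact/measurable_EFinP.
Qed.

Lemma subexp_le_Rintegral f g : subexp f -> subexp g -> (forall x, f x <= g x) ->
  (\int[mu]_x f x <= \int[mu]_x g x)%R.
Proof.
by move=> hf hg fg; apply: le_Rintegral => //; exact: subexp_integrable.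
Qed.

Lemma subexp_RintegralD f g : subexp f -> subexp g ->
  (\int[mu]_x (f x + g x) = \int[mu]_x f x + \int[mu]_x g x)%R.
Proof. by move=> hf hg; rewrite RintegralD//; exact: subexp_integrable. Qed.

Lemma subexp_RintegralB f g : subexp f -> subexp g ->
  (\int[mu]_x (f x - g x) = \int[mu]_x f x - \int[mu]_x g x)%R.
Proof. by move=> hf hg; rewrite RintegralB//; exact: subexp_integrable. Qed.

Lemma subexp_RintegralZ r f : subexp f ->
  (\int[mu]_x (r * f x) = r * \int[mu]_x f x)%R.
Proof. by move=> hf; rewrite RintegralZl//; exact: subexp_integrable. Qed.

Lemma Rintegral_cst1 r : (\int[mu]_x r = r)%R.
Proof. by rewrite Rintegral_cst// mu1 mulr1. Qed.

Lemma subexp_integralE f : subexp f ->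
  (\int[mu]_x (f x)%:E = (\int[mu]_x f x)%R%:E)%E.
Proof.
by move=> hf; rewrite fineK//; apply: integrable_fin_num => //; exact: subexp_integrable.
Qed.

(** Jensen's inequality, obtained by integrating the tangent line of the exponential at the mean of
    [g]. *)
Lemma expR_Rintegral_le (g : 'rV[R]_d -> R) : measurable_fun setT (g : E -> R) ->
  sublinear g -> expR (\int[mu]_x g x)%R <= (\int[mu]_x expR (g x))%R.
Proof.
move=> mg sg; have hg := subexp_sublinear mg sg; have he := subexp_expR mg sg.
set m := (\int[mu]_x g x)%R.
have : (\int[mu]_x (expR m * (1 - m) + expR m * g x) <= \int[mu]_x expR (g x))%R.
  apply: subexp_le_Rintegral => //.
    by apply: subexpD; [exact: subexp_cst|exact: subexpZ].
  move=> x; have := expR_ge1Dx (g x - m).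
  rewrite -(ler_pM2l (expR_gt0 m)) -expRD.
  have -> : m + (g x - m) = g x by ring.
  by rewrite !mulrDr; lra.
rewrite subexp_RintegralD; [|exact: subexp_cst|exact: subexpZ].
by rewrite Rintegral_cst1 subexp_RintegralZ// -/m -mulrDr subrK mulr1.
Qed.

Lemma Rintegral_expR_gt0 (g : 'rV[R]_d -> R) : measurable_fun setT (g : E -> R) ->
  sublinear g -> (0 < \int[mu]_x expR (g x))%R.
Proof.
by move=> mg sg; apply: lt_le_trans (expR_Rintegral_le mg sg); exact: expR_gt0.
Qed.

End integral.
End Borel.

(** * Smooth maxima of finitely many affine functions *)

Section Chain.
Context {R : realType} {V : normedModType R}.

Lemma differentiable_comp1 (f : V -> R) (h : R -> R) (h' : R) (x : V) :
  differentiable f x -> is_derive (f x) 1 h h' ->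
  differentiable (h \o f) x /\ forall u, 'd (h \o f) x u = h' * 'd f x u.
Proof.
move=> df dh.
have dh1 : differentiable h (f x) by apply/derivable1_diffP.
split; first exact: differentiable_comp.
move=> u; rewrite diff_comp//= deriv1E// derive1E derive_val.
by rewrite /GRing.scale/= mulrC.
Qed.

End Chain.

Section Dotp.
Context {R : realType} {d : nat}.
Implicit Types x v u : 'rV[R]_d.

Let dotp_is_linear v : linear (dotp v).
Proof. by move=> a x y; rewrite dotpDr dotpZr. Qed.

HB.instance Definition _ v := GRing.isLinear.Build R 'rV[R]_d R _ (dotp v)
  (dotp_is_linear v).

Lemma differentiable_dotp v x : differentiable (dotp v) x.
Proof. by apply: linear_differentiable; exact: dotp_continuous. Qed.

Lemma diff_dotp v x u : 'd (dotp v) x u = dotp v u.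
Proof. by rewrite diff_lin//; exact: dotp_continuous. Qed.

End Dotp.

Section Softmax.
Context {R : realType} {d n : nat}.
Variables (v : 'I_n.+1 -> 'rV[R]_d) (b : 'I_n.+1 -> R) (beta : R).
Hypothesis beta0 : 0 < beta.
Implicit Types (x y : 'rV[R]_d).

Definition aff i x : R := dotp (v i) x + b i.

Definition sumexp x : R := \sum_i expR (beta * aff i x).

(** Log-sum-exp at inverse temperature [beta]: a smooth convex function lying above the maximum of
    the [aff i] by at most [ln n.+1 / beta]. Its gradient is the average of the slopes [v i] under
    the Gibbs weights [softw]. *)
Definition softmax x : R := beta^-1 * ln (sumexp x).

Definition softw i x : R := expR (beta * aff i x) / sumexp x.

Lemma sumexp_gt0 x : 0 < sumexp x.
Proof.
rewrite /sumexp (bigD1 ord0)//= ltr_pwDl ?expR_gt0//.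
by apply: sumr_ge0 => i _; exact: expR_ge0.
Qed.

Lemma expR_softmax x : expR (beta * softmax x) = sumexp x.
Proof. by rewrite mulrA divff ?gt_eqF// mul1r lnK// posrE sumexp_gt0. Qed.

Lemma softw_ge0 i x : 0 <= softw i x.
Proof. by rewrite divr_ge0 ?expR_ge0// ltW// sumexp_gt0. Qed.

Lemma sum_softw x : \sum_i softw i x = 1.
Proof. by rewrite -mulr_suml divff// gt_eqF// sumexp_gt0. Qed.

Lemma softwE i x : softw i x = expR (beta * (aff i x - softmax x)).
Proof. by rewrite mulrBr expRB expR_softmax. Qed.

Lemma softmax_le x M : sumexp x <= expR (beta * M) -> softmax x <= M.
Proof. by rewrite -expR_softmax ler_expR ler_pM2l. Qed.

Lemma aff_le_softmax i x : aff i x <= softmax x.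
Proof.
rewrite -(ler_pM2l beta0) -ler_expR expR_softmax /sumexp (bigD1 i)//= lerDl.
by apply: sumr_ge0 => j _; exact: expR_ge0.
Qed.

Lemma softmax_le_max x M : (forall i, aff i x <= M) ->
  softmax x <= M + beta^-1 * ln n.+1%:R.
Proof.
move=> h; apply: softmax_le; rewrite mulrDr mulrA divff ?gt_eqF// mul1r expRD.
rewrite lnK ?posrE// mulr_natr -[n.+1 in leRHS]card_ord -sumr_const.
by apply: ler_sum => i _; rewrite ler_expR ler_pM2l.
Qed.

Lemma softmax_convex : convex_function setT softmax.
Proof.
suff H (t : R) x y : 0 <= t -> t <= 1 ->
    softmax (t *: x + (1 - t) *: y) <= t * softmax x + (1 - t) * softmax y.
  by move=> t x y _ _; exact: H.
move=> t0 t1; apply: softmax_le.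
(* After division by the right side, each summand is a weighted geometric mean of the Gibbs weights
   at [x] and [y], hence at most their weighted arithmetic mean; these means sum to 1. *)
rewrite -[leRHS]mulr1 -ler_pdivrMl ?expR_gt0// -expRN.
have {3}-> : 1 = t * \sum_i softw i x + (1 - t) * \sum_i softw i y :> R.
  by rewrite !sum_softw; ring.
rewrite !mulr_sumr -big_split/=; apply: ler_sum => i _.
rewrite -expRD !softwE.
set p := beta * (aff i x - _); set q := beta * (aff i y - _).
have H : expR (t * p + (1 - t) * q) <= t * expR p + (1 - t) * expR q.
  exact: (convex_expR (Itv01 t0 t1) p q).
apply: le_trans H; rewrite ler_expR /p /q /aff dotpDr !dotpZr; lra.
Qed.

Lemma softmax_lipschitz : lipschitz softmax.
Proof.
(* The sum dominates every slope; the factor [d] compares the Euclidean norm with the sup norm used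
   by [lipschitz]. *)
pose L := d%:R * \sum_i enorm (v i).
have L0 : 0 <= L by rewrite mulr_ge0// sumr_ge0// => i _; exact: enorm_ge0.
have half x y : softmax x - softmax y <= L * `|x - y|.
  rewrite lerBlDl -[leLHS]opprK lerNl; rewrite lerNl opprK.
  apply: softmax_le; rewrite mulrDr expRD expR_softmax /sumexp mulr_suml.
  apply: ler_sum => i _; rewrite -expRD ler_expR -mulrDr ler_pM2l//.
  have -> : aff i x = aff i y + dotp (v i) (x - y).
    by rewrite /aff dotpDr dotpNr; ring.
  rewrite lerD2l; apply: le_trans (dotp_le_enorm _ _) _.
  rewrite mulrC /L mulrAC; apply: ler_pM; rewrite ?enorm_ge0//.
    apply: le_trans (enorm_le_sum _) _.
    rewrite mulr_natl -[X in _ *+ X](card_ord d) -sumr_const.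
    apply: ler_sum => j _; rewrite [leRHS]mx_normrE.
    exact: (le_bigmax _ (fun ij => `|(x - y) ij.1 ij.2|) (ord0, j)).
  rewrite (bigD1 i)//= lerDl.
  by apply: sumr_ge0 => j _; exact: enorm_ge0.
apply/(@klipschitzW _ _ _ L) => //.
  exact: (@globally_properfilter _ _ (0, 0)).
move=> [x y] _ /=; rewrite ler_norml lerNl opprB half andbT.
by rewrite distrC half.
Qed.

Lemma diff_exp_aff i x : differentiable (fun x => expR (beta * aff i x)) x /\
  forall u, 'd (fun x => expR (beta * aff i x)) x u =
            expR (beta * aff i x) * (beta * dotp (v i) u).
Proof.
have db : is_derive (dotp (v i) x) 1 (fun y : R => beta * (y + b i)) beta.
  by apply: is_derive_eq; rewrite /GRing.scale/=; ring.
have [dl dlE] := differentiable_comp1 (differentiable_dotp _ _) db.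
have [de deE] := differentiable_comp1 dl (is_derive_expR _).
by split=> [//|u]; rewrite deE dlE diff_dotp.
Qed.

Lemma diff_softmax x : differentiable softmax x /\
  forall u, 'd softmax x u = dotp (\sum_i softw i x *: v i) u.
Proof.
have sumE : sumexp = \sum_i (fun x => expR (beta * aff i x)).
  by apply/funext => y; rewrite fct_sumE.
have ds : differentiable sumexp x.
  by rewrite sumE; apply: differentiable_sum => i; exact: (diff_exp_aff i x).1.
have dsE u : 'd sumexp x u = \sum_i expR (beta * aff i x) * (beta * dotp (v i) u).
  rewrite -deriveE// sumE derive_sum => [|i]; last first.
    exact/diff_derivable/(diff_exp_aff i x).1.
  apply: eq_bigr => i _; rewrite deriveE ?(diff_exp_aff i x).2//.
  exact: (diff_exp_aff i x).1.
have [dl dlE] := differentiable_comp1 ds (is_derive1_ln (sumexp_gt0 x)).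
have db : is_derive (ln (sumexp x)) 1 (fun y : R => beta^-1 * y) beta^-1.
  by apply: is_derive_eq; rewrite /GRing.scale/=; ring.
have [dm dmE] := differentiable_comp1 dl db.
split=> [//|u]; rewrite dmE dlE dsE dotp_suml !mulr_sumr.
apply: eq_bigr => i _; rewrite dotpZl /softw.
by rewrite [RHS]mulrAC; field; rewrite !gt_eqF// sumexp_gt0.
Qed.

Lemma gradient_softmax x : gradient softmax x = \sum_i softw i x *: v i.
Proof.
apply/rowP => j; rewrite mxE deriveE ?(diff_softmax x).2; last exact: (diff_softmax x).1.
set S := \sum_i _; rewrite /dotp (bigD1 j)//= big1 => [|k kj]; last first.
  by rewrite [X in _ * X]mxE (negbTE kj) andbF mulr0.
by rewrite [X in _ * X]mxE !eqxx mulr1 addr0.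
Qed.

Lemma softmax_C1 : C1 softmax.
Proof.
split=> [x|]; first exact: (diff_softmax x).1.
rewrite (_ : gradient softmax = fun x => \sum_i softw i x *: v i); last first.
  by apply/funext => x; exact: gradient_softmax.
have ce i : continuous (fun x => expR (beta * aff i x)).
  by move=> x; apply: differentiable_continuous; exact: (diff_exp_aff i x).1.
have cs : continuous sumexp.
  by apply: continuous_big => [|i _]; [exact: add_continuous|exact: ce].
apply: continuous_big => [|i _ x]; first exact: add_continuous.
apply: continuousZr_tmp; apply: continuousM; first exact: ce.
by apply: continuousV; [rewrite gt_eqF// sumexp_gt0|exact: cs].
Qed.

End Softmax.

(** * Integration against an average of kernels *)

Section KernelIntegral.
Local Open Scope ereal_scope.
Context {dT dE} {T : measurableType dT} {E : measurableType dE} {R : realType}.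
Variables (m : {measure set T -> \bar R}) (k : R.-ker T ~> E).
Variable nu : {measure set E -> \bar R}.
Hypothesis nuE : forall B, measurable B -> nu B = \int[m]_t k t B.

Import HBNNSimple.

Lemma measurable_kernel_integral (f : E -> \bar R) : (forall x, 0 <= f x) ->
  measurable_fun setT f -> measurable_fun setT (fun t => \int[k t]_x f x).
Proof.
move=> f0 mf; apply: measurable_fun_integral_kernel => // U mU.
exact: measurable_kernel.
Qed.

Let kernel_integral_nnsfun (f : {nnsfun E >-> R}) :
  \int[nu]_x (f x)%:E = \int[m]_t \int[k t]_x (f x)%:E.
Proof.
under [in LHS]eq_integral do rewrite fimfunE -fsumEFin//.
rewrite ge0_integral_fsum//; last 2 first.
  - by move=> r; exact/measurable_EFinP/measurableT_comp.
  - by move=> r z _; rewrite EFinM nnfun_muleindic_ge0.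
under [in RHS]eq_integral.
  move=> t _.
  under eq_integral.
    by move=> x _; rewrite fimfunE -fsumEFin//; over.
  rewrite /= ge0_integral_fsum//; last 2 first.
    - by move=> r; exact/measurable_EFinP/measurableT_comp.
    - by move=> r z _; rewrite EFinM nnfun_muleindic_ge0.
  over.
rewrite /= ge0_integral_fsum//; last 2 first.
  - move=> r; apply: measurable_kernel_integral.
      by move=> x; rewrite EFinM nnfun_muleindic_ge0.
    by apply/measurable_EFinP; exact: measurableT_comp.
  - by move=> r t _; apply: integral_ge0 => x _; rewrite EFinM nnfun_muleindic_ge0.
apply: eq_fsbigr => r _.
have [r0|r0] := leP 0%R r; last first.
  rewrite integral0_eq => [|x _]; last by rewrite preimage_nnfun0// indic0 mulr0.
  rewrite integral0_eq// => t _.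
  by rewrite integral0_eq// => x _; rewrite preimage_nnfun0// indic0 mulr0.
have mr : measurable (f @^-1` [set r]) by [].
rewrite (integralZl_indic _ (fun r => f @^-1` [set r]))//; last first.
  by move=> r0'; rewrite preimage_nnfun0.
under [in RHS]eq_integral.
  move=> t _; rewrite (integralZl_indic _ (fun r => f @^-1` [set r]))//; last first.
    by move=> r0'; rewrite preimage_nnfun0.
  rewrite integral_indic// setIT; over.
rewrite ge0_integralZl//.
  by rewrite integral_indic// setIT nuE.
exact: measurable_kernel.
Qed.

(** Simple functions first, then monotone convergence under [nu], under each [k t] and under [m]. It
    serves twice: for the mixture, and for the second marginal of a coupling. *)
Lemma kernel_integral (f : E -> \bar R) : (forall x, 0 <= f x) ->
  measurable_fun setT f -> \int[nu]_x f x = \int[m]_t \int[k t]_x f x.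
Proof.
move=> f0 mf; pose f_ := nnsfun_approx measurableT mf.
have lim_integral (mu : {measure set E -> \bar R}) :
    \int[mu]_x f x = lim ((\int[mu]_x (f_ n x)%:E) @[n --> \oo]).
  rewrite -monotone_convergence//; last 3 first.
    - by move=> n; exact/measurable_EFinP.
    - by move=> n x _; rewrite lee_fin.
    - by move=> x _ a b ab; rewrite lee_fin; exact/lefP/nd_nnsfun_approx.
  by apply: eq_integral => x _; apply/esym/cvg_lim => //; exact: cvg_nnsfun_approx.
rewrite lim_integral.
under eq_fun do rewrite kernel_integral_nnsfun.
rewrite -monotone_convergence//; last 3 first.
- move=> n; apply: measurable_kernel_integral => [x|]; first by rewrite lee_fin.
  exact/measurable_EFinP.
- by move=> n t _; apply: integral_ge0 => x _; rewrite lee_fin.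
- move=> t _ a b ab; apply: ge0_le_integral => //.
  + by move=> x _; rewrite lee_fin.
  + exact/measurable_EFinP.
  + exact/measurable_EFinP.
  + by move=> x _; rewrite lee_fin; exact/lefP/nd_nnsfun_approx.
by apply: eq_integral => t _; rewrite lim_integral.
Qed.

End KernelIntegral.

(** * Weak transport inequality for functions with subgradients *)

Section Transport.
Context {R : realType} {d : nat}.
Notation E := (borel_rV R d).
Implicit Types (x y z : 'rV[R]_d).

Lemma dotp_barycenter (mu : {measure set E -> \bar R}) v :
  (\int[mu]_x (enorm x)%:E < +oo)%E ->
  mu.-integrable setT (EFin \o (dotp v : E -> R)) /\
  (\int[mu]_x dotp v x)%R = dotp v (barycenter mu).
Proof.
move=> fin.
have ie : mu.-integrable setT (EFin \o (@enorm R d : E -> R)).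
  apply/integrableP; split; first by apply/measurable_EFinP; exact: subexp_enorm.1.
  by under eq_integral do rewrite /= ger0_norm ?enorm_ge0//.
have ic i : mu.-integrable setT (EFin \o (fun x : 'rV[R]_d => x ord0 i : R)).
  apply: (le_integrable _ _ _ ie) => //.
    by apply/measurable_EFinP; exact: measurable_coord.
  by move=> x _; rewrite /= lee_fin [leRHS]ger0_norm ?enorm_ge0// coord_le_enorm.
have ic' i : mu.-integrable setT (EFin \o (fun x : 'rV[R]_d => v ord0 i * x ord0 i)).
  exact: (integrableZl measurableT (v ord0 i) (ic i)).
(* Induction over a list of coordinates carries integrability along with the value of the
   integral. *)
pose h (s : seq 'I_d) (x : E) := \sum_(i <- s) v ord0 i * (x : 'rV[R]_d) ord0 i.
have key (s : seq 'I_d) : mu.-integrable setT (EFin \o h s) /\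
    (\int[mu]_x h s x)%R = \sum_(i <- s) v ord0 i * barycenter mu ord0 i.
  elim: s => [|i s [IH1 IH2]].
    have -> : h [::] = cst 0 by apply/funext => x; rewrite /h big_nil.
    split; first exact: integrable0.
    by rewrite big_nil /Rintegral integral0.
  have -> : h (i :: s) = fun x => v ord0 i * (x : 'rV[R]_d) ord0 i + h s x.
    by apply/funext => x; rewrite /h big_cons.
  rewrite big_cons RintegralD// IH2 RintegralZl// [in RHS]mxE; split => //.
  exact: (integrableD measurableT (ic' i) IH1).
exact: (key (index_enum _)).
Qed.

Section transport.
Variables (p : R) (mu mu' : {measure set E -> \bar R}) (k : R.-pker E ~> E).
Hypothesis kE : forall B, measurable B -> mu' B = (\int[mu]_x k x B)%E.
Hypothesis mu'exp : (\int[mu']_x (enorm x)%:E < +oo)%E.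

Lemma measurable_barycenter i : measurable_fun setT (fun x : E => barycenter (k x) ord0 i).
Proof.
rewrite /barycenter; under eq_fun do rewrite mxE.
apply: (measurableT_comp (f := @fine R)) => //.
have mc := @measurable_coord R d i.
pose f (x : 'rV[R]_d) : \bar R := (x ord0 i)%:E.
(* Positive and negative parts give kernel integrals of nonnegative functions, so measurability
   holds even where the first moment is infinite. *)
rewrite (_ : (fun x => _) = (fun x => \int[k x]_y (f ^\+ y) - \int[k x]_y (f ^\- y))%E); last first.
  by apply/funext => x; rewrite integralE.
apply: emeasurable_funB; apply: measurable_kernel_integral => //.
  by apply: measurable_funepos; exact/measurable_EFinP.
by apply: measurable_funeneg; exact/measurable_EFinP.
Qed.

Lemma transport_le (phi Rf : E -> R) (v : 'rV[R]_d -> 'rV[R]_d) (b kappa D : R) :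
  measurable_fun setT phi -> (forall x, b <= phi x) ->
  (forall x y, phi x + dotp (v x) (y - x) <= phi y) ->
  measurable_fun setT Rf -> (forall x, 0 <= Rf x) -> 0 <= kappa ->
  (forall x z, dotp (v x) z <= Rf x + kappa * wcost p z) ->
  (\int[mu]_x (wcost p (x - barycenter (k x)))%:E <= D%:E)%E ->
  (\int[mu]_x (phi x - b)%:E <=
   \int[mu']_x (phi x - b)%:E + \int[mu]_x (Rf x)%:E + (kappa * D)%:E)%E.
Proof.
move=> mphi bphi tphi mR R0 kappa0 young wD.
have mphib : measurable_fun setT (fun x : E => (phi x - b)%:E).
  by apply/measurable_EFinP; exact: measurable_funB.
have phib0 x : (0 <= (phi x - b)%:E)%E by rewrite lee_fin subr_ge0.
have w0 x : 0 <= wcost p x by rewrite addr_ge0// ?powR_ge0// sqr_ge0.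
have mw : measurable_fun setT (fun x : E => wcost p ((x : 'rV[R]_d) - barycenter (k x))).
  apply: measurable_wcost => i.
  under eq_fun do rewrite mxE [(- _ : 'rV_d) _ _]mxE.
  apply: measurable_funB; first exact: measurable_coord.
  exact: measurable_barycenter.
have me : measurable_fun setT (fun x : E => (enorm x)%:E).
  by apply/measurable_EFinP; exact: subexp_enorm.1.
have e0 x : (0 <= (@enorm R d x)%:E)%E by rewrite lee_fin enorm_ge0.
have mke : measurable_fun setT (fun x : E => (\int[k x]_y (enorm y)%:E)%E).
  exact: measurable_kernel_integral.
(* The finite first moment of [mu'] passes to [k x] for almost every [x], where the barycenter is a
   genuine mean. *)
have ike : mu.-integrable setT (fun x => \int[k x]_y (enorm y)%:E)%E.
  apply/integrableP; split => //.
  under eq_integral do rewrite gee0_abs ?integral_ge0//.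
  by rewrite -(kernel_integral kE).
have jensen x : (\int[k x]_y (enorm y)%:E < +oo)%E ->
    ((phi (barycenter (k x)) - b)%:E <= \int[k x]_y (phi y - b)%:E)%E.
  move=> fx; set y0 := barycenter (k x).
  have [id_ idE] := dotp_barycenter (v y0) fx.
  (* An infinite right side is trivial; otherwise [phi] is integrable and can be compared with its
     tangent at the barycenter. *)
  have [->|] := eqVneq (\int[k x]_y (phi y - b)%:E)%E +oo%E; first by rewrite leey.
  rewrite -ltey => fin.
  have ip : (k x).-integrable setT (EFin \o (fun y => phi y - b)).
    apply/integrableP; split => //.
    by under eq_integral do rewrite /= ger0_norm ?subr_ge0//.
  have ic r : (k x).-integrable setT (EFin \o (fun _ : E => r)).
    apply/integrableP; split; first exact/measurable_EFinP.
    by rewrite integral_cst// prob_kernel mule1 ltry.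
  have il : (k x).-integrable setT
      (EFin \o (fun y => (phi y0 - b - dotp (v y0) y0) + dotp (v y0) y)).
    exact: (integrableD measurableT (ic _) id_).
  have := @le_Rintegral _ _ _ (k x) setT _ _ measurableT il ip.
  rewrite RintegralD// idE Rintegral_cst// prob_kernel mulr1 subrK => H.
  rewrite -[X in (_ <= X)%E]fineK; last by rewrite ge0_fin_numE// integral_ge0.
  rewrite lee_fin; apply: H => y _.
  by have := tphi y0 y; rewrite dotpDr dotpNr; lra.
have step : (\forall x \ae mu, setT x ->
    ((phi x - b)%:E <= \int[k x]_y (phi y - b)%:E + (Rf x)%:E +
     (kappa * wcost p ((x : 'rV[R]_d) - barycenter (k x)))%:E)%E).
  have := integrable_ae measurableT ike.
  apply: filterS => x /(_ I); rewrite ge0_fin_numE ?integral_ge0// => fx _.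
  apply: (@le_trans _ _ ((phi (barycenter (k x)) - b)%:E + (Rf x)%:E +
     (kappa * wcost p ((x : 'rV[R]_d) - barycenter (k x)))%:E)%E); last first.
    by apply: leeD => //; apply: leeD => //; exact: jensen.
  rewrite -!EFinD lee_fin.
  have := tphi x (barycenter (k x)); rewrite -opprB dotpNr => H.
  by have := young x (x - barycenter (k x)); lra.
have mG : measurable_fun setT (fun x : E => (\int[k x]_y (phi y - b)%:E)%E).
  exact: measurable_kernel_integral.
have mRE : measurable_fun setT (fun x : E => (Rf x)%:E) by exact/measurable_EFinP.
have mkw : measurable_fun setT
    (fun x : E => (kappa * wcost p ((x : 'rV[R]_d) - barycenter (k x)))%:E).
  by apply/measurable_EFinP; apply: measurable_funM.
have G0 x : (0 <= \int[k x]_y (phi y - b)%:E)%E by exact: integral_ge0.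
apply: (@le_trans _ _ (\int[mu]_x (\int[k x]_y (phi y - b)%:E + (Rf x)%:E +
     (kappa * wcost p ((x : 'rV[R]_d) - barycenter (k x)))%:E))%E).
  apply: ae_ge0_le_integral => //.
  - move=> x _; apply: adde_ge0; last by rewrite lee_fin mulr_ge0.
    by apply: adde_ge0; rewrite ?lee_fin.
  - by apply: emeasurable_funD => //; apply: emeasurable_funD.
rewrite ge0_integralD//; last 3 first.
- by move=> x _; rewrite adde_ge0// lee_fin.
- exact: emeasurable_funD.
- by move=> x _; rewrite lee_fin mulr_ge0.
rewrite ge0_integralD//; last by move=> x _; rewrite lee_fin.
rewrite (kernel_integral kE)//; apply: leeD => //.
under eq_integral do rewrite EFinM.
rewrite ge0_integralZl//; last by move=> x _; rewrite lee_fin.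
  by rewrite EFinM; apply: lee_wpmul2l; rewrite ?lee_fin.
exact/measurable_EFinP.
Qed.

End transport.
End Transport.

(** * The class of test functions *)

Section AdmissibleFunctions.
Context {R : realType} {d : nat}.
Implicit Types (f g : 'rV[R]_d -> R).

Definition admissible f :=
  [/\ convex_function setT f, lipschitz f, C1 f & bounded_below f].

Lemma C1_continuous f : C1 f -> continuous f.
Proof. by move=> [df _] x; exact/differentiable_continuous/df. Qed.

Lemma admissible_measurable f : admissible f ->
  measurable_fun setT (f : borel_rV R d -> R).
Proof. by move=> [_ _ /C1_continuous cf _]; exact: continuous_borel_measurable. Qed.

Lemma admissible_sublinear f : admissible f -> sublinear f.
Proof. by move=> [_ /sublinear_lipschitz]. Qed.

Lemma gradientZ f (t : R) : C1 f ->
  gradient (fun x => t * f x) = fun x => t *: gradient f x.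
Proof.
move=> [df _]; apply/funext => x; apply/rowP => i; rewrite !mxE.
by rewrite (@deriveZ _ _ _ f t x)//; exact: diff_derivable.
Qed.

Lemma admissibleZ f (t : R) : 0 <= t -> admissible f ->
  admissible (fun x => t * f x).
Proof.
move=> t0 [cf lf Cf [b bf]]; have [df cgf] := Cf; split.
- move=> s x y xT yT.
  have H := cf s x y xT yT.
  have := ler_wpM2l t0 H; rewrite /conv/= /conv/= /GRing.scale/= mulrDr.
  by rewrite mulrCA [X in _ <= _ + X]mulrCA.
- have pf : ProperFilter (globally (@setT 'rV[R]_d `*` @setT 'rV[R]_d)).
    exact: (@globally_properfilter _ _ (0, 0)).
  move/ex_dom_bound : lf => [M HM]; apply/ex_dom_bound; exists (t * M) => -[x y] xy /=.
  rewrite -mulrBr normrM ger0_norm// -mulrA ler_wpM2l//.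
  exact: (HM (x, y) xy).
- split=> [x|]; first by apply: (@differentiableZ _ _ _ f t x).
  rewrite gradientZ// => x.
  by apply: continuousZ; [exact: cst_continuous|exact: cgf].
by exists (t * b) => x; rewrite ler_wpM2l.
Qed.

(** Partial derivatives are limits of difference quotients controlled by the Lipschitz constant.
    Boundedness of the gradient bounds its conjugate cost, which makes every integral in the
    argument finite. *)
Lemma gradient_bounded f : lipschitz f -> (forall x, differentiable f x) ->
  exists M, forall x, enorm (gradient f x) <= M.
Proof.
have pf : ProperFilter (globally (@setT 'rV[R]_d `*` @setT 'rV[R]_d)).
  exact: (@globally_properfilter _ _ (0, 0)).
move=> /ex_dom_bound [L HL] df.
exists (\sum_(i < d) `|L| * `|delta_mx ord0 i : 'rV[R]_d|) => x.
apply: le_trans (enorm_le_sum _) _; apply: ler_sum => i _; rewrite mxE.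
set e := delta_mx _ _.
have dv : (fun h : R => h^-1 *: ((f \o shift x) (h *: e) - f x)) @ (0 : R)^' -->
    'D_e f x by exact: diff_derivable.
have /(_ _) ndv := cvg_norm dv.
rewrite -(cvg_lim _ ndv)//.
apply: limr_le; first by apply/cvg_ex; eexists; exact: ndv.
near=> h.
have h0 : h != 0 by near: h; exact: nbhs_dnbhs_neq.
rewrite /GRing.scale/= normrM normfV ler_pdivrMl ?normr_gt0//.
have := HL (h *: e + x, x) (conj I I); rewrite /= addrK normrZ => H.
apply: le_trans H _; rewrite mulrCA ler_wpM2l// ler_wpM2r//.
exact: ler_norm.
Unshelve. all: by end_near.
Qed.

End AdmissibleFunctions.

(** * Elementary bounds for exponentials, logarithms and geometric sums *)

Section ExpBounds.
Context {R : realType}.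
Implicit Types u : R.

Lemma expR_sub1_le u : expR u - 1 <= u * expR u.
Proof.
have := expR_ge1Dx (- u); rewrite -(ler_pM2l (expR_gt0 u)) -expRD subrr expR0.
by rewrite mulrDr mulr1 mulrN; lra.
Qed.

Lemma expR_taylor2 u : expR u <= 1 + u + u ^+ 2 * expR `|u|.
Proof.
have h1 := expR_sub1_le u; have h2 := expR_ge1Dx u.
have [u0|u0] := leP 0 u.
  rewrite ger0_norm//.
  have : u * (expR u - 1) <= u * (u * expR u) by rewrite ler_wpM2l.
  lra.
have : 1 <= expR `|u| by rewrite -expR0 ler_expR.
have : u * (expR u - 1) <= u * u by apply: ler_wnM2l; [exact: ltW|lra].
have : 0 <= u * u by rewrite -expr2 sqr_ge0.
nra.
Qed.

Lemma le_ln_sub1 u : 0 < u -> ln u <= u - 1.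
Proof. by move=> u0; have := @le_ln1Dx R (u - 1); rewrite [1 + _]addrC subrK; apply; lra. Qed.

Lemma exists_half_pow_mul_le (M e : R) : 0 <= M -> 0 < e ->
  exists k, 2^-1 ^+ k * M <= e.
Proof.
move=> M0 e0; exists (Num.bound (M / e)).
have := archi_boundP (divr_ge0 M0 (ltW e0)); set k := Num.bound _ => kb.
have k2 : k%:R <= 2 ^+ k :> R by rewrite -natrX ler_nat ltnW// ltn_expl.
rewrite exprVn ler_pdivrMl ?exprn_gt0// -ler_pdivrMr//.
exact: le_trans (ltW kb) k2.
Qed.

Lemma sum_geometric_le (q : R) k : 0 < q < 1 -> \sum_(i < k) q ^+ i <= (1 - q)^-1.
Proof.
move=> /andP[q0 q1].
have E k' : (1 - q) * \sum_(i < k') q ^+ i = 1 - q ^+ k'.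
  elim: k' => [|k' IH]; first by rewrite big_ord0 mulr0 expr0 subrr.
  by rewrite big_ord_recr/= mulrDr IH exprS; ring.
rewrite -[leRHS]mulr1 ler_pdivlMl ?subr_gt0// E.
by rewrite lerBlDr lerDl exprn_ge0// ltW.
Qed.

End ExpBounds.

(** * Herbst's argument by dyadic halving *)

Section Herbst.
Context {R : realType} {d : nat}.
Notation E := (borel_rV R d).
Variable c : 'rV[R]_d -> R.
Hypothesis fin : forall v, conjugate c v \is a fin_num.
Hypothesis cs0 : forall v, 0 <= conjr c v.
Variable mu : {measure set E -> \bar R}.
Hypothesis mu1 : mu setT = 1%E.
Hypothesis muexp : forall s, 0 < s -> (\int[mu]_x (expR (s * enorm x))%:E < +oo)%E.
Variable C : R.
Hypothesis C0 : 0 < C.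
Hypothesis mLS : conv_mLS c mu C.

Lemma subexp_conjr_gradient f r : admissible f ->
  (forall x, conjr c (gradient f x) <= r) ->
  subexp (fun x : E => conjr c (gradient f x)).
Proof.
move=> [_ _ [_ cf] _] hr; apply: (@subexp_bounded _ _ _ r).
  exact: measurable_conjr.
by move=> x; rewrite ger0_norm.
Qed.

Lemma mLS_Rintegral f r : admissible f -> (forall x, conjr c (gradient f x) <= r) ->
  (\int[mu]_x (f x * expR (f x)))%R
    - (\int[mu]_x expR (f x))%R * ln (\int[mu]_x expR (f x))%R <=
  C * (\int[mu]_x (conjr c (gradient f x) * expR (f x)))%R.
Proof.
move=> af hr; have [cf lf Cf bf] := af.
have mf := admissible_measurable af; have sf := admissible_sublinear af.
have he := subexp_expR mf sf; have hf := subexp_sublinear mf sf.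
have hJ := subexpM (subexp_conjr_gradient af hr) he.
have F0 := Rintegral_expR_gt0 mu1 muexp mf sf.
have := mLS cf lf Cf bf; rewrite /Ent.
under eq_integral do rewrite expRK mulrC.
under [X in (_ <= _ * X)%E]eq_integral do rewrite conjrE// -EFinM.
rewrite (subexp_integralE muexp (subexpM hf he)) (subexp_integralE muexp he).
by rewrite (subexp_integralE muexp hJ) lne_EFin//.
Qed.

(* Halving the exponent instead of differentiating: by Jensen
   [ln I(t/2) >= ln I(t) - t/2 * nu(g)] where [nu] has density [e^(tg) / I(t)],
   and the log-Sobolev inequality at [t g] bounds [nu(g)]. *)
Lemma herbst_step g (r t alpha : R) : admissible g ->
  (forall x, conjr c (gradient g x) <= r) ->
  (forall v s, 0 <= s <= 1 -> conjr c (s *: v) <= s `^ alpha * conjr c v) ->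
  0 < t <= 1 ->
  ln (\int[mu]_x expR (t * g x))%R / t <=
  ln (\int[mu]_x expR (t / 2 * g x))%R / (t / 2) + C * r * t `^ (alpha - 1).
Proof.
move=> ag gr sc /andP[t0 t1].
have atg := admissibleZ (ltW t0) ag.
have ath := @admissibleZ _ _ g (t / 2) (ltW (divr_gt0 t0 (ltr0n _ 2))) ag.
have mt := admissible_measurable atg; have st := admissible_sublinear atg.
have mh := admissible_measurable ath; have sh := admissible_sublinear ath.
have [_ _ Cg _] := ag.
have gradt x : conjr c (gradient (fun y => t * g y) x) <= t `^ alpha * r.
  rewrite gradientZ//; apply: le_trans (sc _ _ _) _; first by rewrite (ltW t0).
  by rewrite ler_wpM2l// powR_ge0.
have h := mLS_Rintegral atg gradt.
have het := subexp_expR mt st; have hft := subexp_sublinear mt st.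
have heh := subexp_expR mh sh.
set I1 := (\int[mu]_x expR (t * g x))%R in h *.
set I2 := (\int[mu]_x expR (t / 2 * g x))%R.
have I1p : 0 < I1 by exact: Rintegral_expR_gt0.
have I2p : 0 < I2 by exact: Rintegral_expR_gt0.
set N := (\int[mu]_x (t * g x * expR (t * g x)))%R in h.
have hR : N - I1 * ln I1 <= C * (t `^ alpha * r * I1).
  apply: le_trans h _; rewrite ler_wpM2l ?(ltW C0)//.
  rewrite -(subexp_RintegralZ muexp _ het); apply: subexp_le_Rintegral => //.
  - by apply: subexpM => //; exact: subexp_conjr_gradient gradt.
  - exact: subexpZ.
  - by move=> x; rewrite ler_wpM2r// expR_ge0.
(* Half the mean of [t * g] under the tilted law of density [expR (t * g x) / I1]. *)
pose a := N / I1 / 2.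
have jensen : I1 * expR (- a) <= I2.
  (* The integrand is the tilted density times the tangent line at [a] of the decreasing exponential
     of [y / 2], [y = t * g x]; it lies below [expR (y / 2)] and integrates exactly to the left
     side. *)
  have -> : I1 * expR (- a) = (\int[mu]_x (expR (- a) * (1 + a) * expR (t * g x)
      - expR (- a) / 2 * (t * g x * expR (t * g x))))%R.
    rewrite subexp_RintegralB//; last 2 first.
    - exact: subexpZ.
    - by apply: subexpZ; exact: subexpM.
    rewrite subexp_RintegralZ// subexp_RintegralZ//; last exact: subexpM.
    by rewrite -/I1 -/N /a; field; rewrite gt_eqF.
  apply: subexp_le_Rintegral => //.
  - apply: subexpB; first exact: subexpZ.
    by apply: subexpZ; exact: subexpM.
  - move=> x; set y := t * g x.
    have -> : t / 2 * g x = y + (- a + (a - y / 2)) by rewrite /y; field.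
    rewrite expRD [expR (- a + _)]expRD; have := expR_ge1Dx (a - y / 2).
    rewrite -(ler_pM2l (mulr_gt0 (expR_gt0 y) (expR_gt0 (- a)))) => H.
    by rewrite [leRHS]mulrA; apply: le_trans H; lra.
clear -I1p I2p hR jensen t0; clearbody I1 I2 N.
have lnle : ln I1 - a <= ln I2.
  rewrite -[leLHS]expRK ler_ln ?posrE ?expR_gt0//.
  by rewrite expRD lnK ?posrE.
have aE : 2 * a <= ln I1 + C * (t `^ alpha * r).
  rewrite /a mulrC divfK//ler_pdivrMr//.
  by rewrite mulrDl [ln I1 * I1]mulrC; lra.
have -> : t `^ (alpha - 1) = t `^ alpha / t.
  by rewrite powRD ?powR_inv1// ?(ltW t0)// (gt_eqF t0) implybT.
rewrite ler_pdivrMr//.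
have -> : (ln I2 / (t / 2) + C * r * (t `^ alpha / t)) * t =
  2 * ln I2 + C * (t `^ alpha * r) by field; rewrite gt_eqF.
by clear -aE lnle; lra.
Qed.

(** Halving from [t = 1] costs [C * r * q ^+ k] at level [2 ^ -k], a geometric series because
    [1 < alpha]. In the limit the rescaled logarithm of the exponential integral is at most the mean
    of [g]. *)
Lemma herbst g (r alpha : R) : admissible g ->
  (forall x, conjr c (gradient g x) <= r) -> 0 <= r -> 1 < alpha ->
  (forall v s, 0 <= s <= 1 -> conjr c (s *: v) <= s `^ alpha * conjr c v) ->
  ln (\int[mu]_x expR (g x))%R <=
  (\int[mu]_x g x)%R + C * r / (1 - 2 `^ (1 - alpha)).
Proof.
move=> ag gr r0 a1 sc; set q := 2 `^ (1 - alpha).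
have q0 : 0 < q by rewrite powR_gt0.
have q1 : q < 1.
  rewrite /q /powR ifF; last by apply/negbTE; lra.
  rewrite -[ltRHS]expR0 ltr_expR pmulr_llt0; first by lra.
  by rewrite ln_gt0; lra.
pose t k : R := 2^-1 ^+ k.
have t0 k : 0 < t k by rewrite exprn_gt0// invr_gt0.
have t1 k : t k <= 1 by rewrite exprn_ile1// invf_le1//; lra.
have tq k : t k `^ (alpha - 1) = q ^+ k.
  have -> : t k = 2 `^ (- k%:R) by rewrite powRN powR_mulrn// /t exprVn.
  by rewrite -powRrM mulrC mulrN -mulNr opprB powRrM powR_mulrn// powR_ge0.
pose psi k := ln (\int[mu]_x expR (t k * g x))%R / t k.
have step k : psi 0%N <= psi k + C * r * \sum_(i < k) q ^+ i.
  elim: k => [|k IH]; first by rewrite big_ord0 mulr0 addr0.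
  apply: le_trans IH _; rewrite big_ord_recr/= mulrDr addrA [X in _ <= X]addrAC lerD2r.
  have := @herbst_step g r (t k) alpha ag gr sc.
  rewrite t0 t1 => /(_ isT); rewrite tq.
  by rewrite [psi k.+1]/psi /t exprSr.
have geo k : \sum_(i < k) q ^+ i <= (1 - q)^-1.
  by apply: sum_geometric_le; rewrite q0.
have mg := admissible_measurable ag; have sg := admissible_sublinear ag.
have hg := subexp_sublinear mg sg.
have hG : subexp (fun x : E => g x ^+ 2 * expR `|g x|).
  apply: subexpM; first by under eq_fun do rewrite expr2; exact: subexpM.
  apply: subexp_expR; first exact: measurableT_comp.
  by case: sg => [a' [L [? ? gL]]]; exists a', L; split => // x; rewrite normr_id.
set M := (\int[mu]_x (g x ^+ 2 * expR `|g x|))%R.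
have M0 : 0 <= M by apply: Rintegral_ge0 => x _; rewrite mulr_ge0 ?expR_ge0// sqr_ge0.
(* [ln u <= u - 1] and a second-order expansion of the exponential leave an error [t k * M], which
   vanishes as [k] grows. *)
have lim k : psi k <= (\int[mu]_x g x)%R + t k * M.
  have atg := admissibleZ (ltW (t0 k)) ag.
  have mt := admissible_measurable atg; have st := admissible_sublinear atg.
  have het := subexp_expR mt st.
  rewrite ler_pdivrMr//; apply: le_trans (le_ln_sub1 _) _.
    exact: Rintegral_expR_gt0.
  have : (\int[mu]_x expR (t k * g x) <= \int[mu]_x (1 + t k * g x + t k ^+ 2 * (g x ^+ 2 * expR `|g x|)))%R.
    apply: subexp_le_Rintegral => //.
      apply: subexpD; last exact: subexpZ.
      by apply: subexpD; [exact: subexp_cst|exact: subexpZ].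
    move=> x; apply: le_trans (expR_taylor2 _) _.
    rewrite lerD2l exprMn [leRHS]mulrA; apply: ler_wpM2l.
      by rewrite mulr_ge0// sqr_ge0.
    by rewrite ler_expR normrM gtr0_norm// ler_piMl.
  rewrite subexp_RintegralD//; last 2 first.
  - by apply: subexpD; [exact: subexp_cst|exact: subexpZ].
  - exact: subexpZ.
  rewrite subexp_RintegralD//; [|exact: subexp_cst|exact: subexpZ].
  by rewrite Rintegral_cst1// !subexp_RintegralZ// -/M; lra.
have -> : ln (\int[mu]_x expR (g x))%R = psi 0%N.
  by rewrite /psi /t expr0 divr1; under [in RHS]eq_Rintegral do rewrite mul1r.
apply/ler_addgt0Pr => e e0.
have [k kM] : exists k, t k * M <= e.
  exact: exists_half_pow_mul_le.
apply: le_trans (step k) _.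
rewrite addrAC; apply: lerD.
  by apply: le_trans (lim k) _; rewrite lerD2l.
by rewrite ler_wpM2l// mulr_ge0// ltW.
Qed.

End Herbst.

(** * Convex minorants with small gradient cost *)

Section TangentEnvelope.
Context {R : realType} {d : nat}.
Variable c : 'rV[R]_d -> R.
Hypothesis fin : forall v, conjugate c v \is a fin_num.
Hypothesis cge0 : forall x, 0 <= c x.

Lemma conjr_at0 : conjr c 0 <= 0.
Proof.
apply/(conjr_le fin) => x.
by rewrite -(scale0r x) dotpZr mul0r sub0r oppr_le0.
Qed.

(** Points of the ball with gradient cost at most [r] form a compact set, by lower semicontinuity of
    the conjugate and continuity of the gradient. Each tangent stays within 1 of [f] on an open
    neighbourhood of its contact point, so finitely many suffice. *)
Lemma finite_tangents f (r rho : R) : admissible f ->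
  exists s : seq 'rV[R]_d, (forall y, y \in s -> conjr c (gradient f y) <= r) /\
  forall x, conjr c (gradient f x) <= r -> enorm x <= rho ->
    exists2 y, y \in s & f x - 1 <= f y + dotp (gradient f y) (x - y).
Proof.
move=> [cf lf Cf bf]; have [df cgf] := Cf; have cnf := C1_continuous Cf.
pose S : set 'rV[R]_d := [set x | conjr c (gradient f x) <= r] `&` [set x | enorm x <= rho].
have cS : compact S.
  apply: bounded_closed_compact.
    exists rho; split; first exact: num_real.
    move=> M rM x [_ /= xr]; apply: le_trans (norm_le_enorm _) _.
    exact: le_trans xr (ltW rM).
  apply: closedI.
    rewrite -[X in closed X]setCK; apply: open_closedC.
    have -> : ~` [set x | conjr c (gradient f x) <= r] =
        gradient f @^-1` [set v | r < conjr c v].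
      by apply/seteqP; split => x /=; rewrite ltNge => /negP.
    by apply: open_comp => [x _|]; [exact: cgf|exact: open_conjr_gt].
  rewrite (_ : [set x | _] = (@enorm R d) @^-1` [set y | y <= rho])//.
  by apply: closed_comp => [x _|]; [exact: enorm_continuous|exact: closed_le].
pose U y : set 'rV[R]_d := [set x | f x - 1 < f y + dotp (gradient f y) (x - y)].
have oU y : open (U y).
  pose h x := f y + dotp (gradient f y) (x - y) - f x.
  rewrite (_ : U y = h @^-1` [set t | -1 < t]); last first.
    by apply/seteqP; split => x; rewrite /U /h /= => ?; lra.
  apply: open_comp => [x _|]; last exact: open_gt.
  have cl : {for x, continuous (fun x : 'rV[R]_d => dotp (gradient f y) (x - y))}.
    apply: (@continuous_comp _ _ _ (fun x : 'rV[R]_d => x - y) (dotp (gradient f y))).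
      apply: (@continuousB _ _ _ id (fun=> y)); last exact: cst_continuous.
      exact: cvg_id.
    exact: dotp_continuous.
  have ca := continuousD (@cst_continuous _ _ (f y) x) cl.
  exact: (continuousB ca (cnf x)).
move: cS; rewrite compact_cover => /(_ _ S U) [||D DS cov].
- by move=> y _.
- move=> x Sx; exists x => //; rewrite /U /= subrr.
  by rewrite -(scale0r x) dotpZr mul0r; lra.
exists (finmap.enum_fset D); split=> [y yD|x xr xrho].
  by have /set_mem [] : y \in S by exact: DS.
have [y yD Uy] := cov x (conj xr xrho).
by exists y => //; exact: ltW.
Qed.

(* [g] is a softmax of finitely many tangents of [f] and of a constant, so its
   gradients are convex combinations of gradients where [conjr c] is small. *)
Lemma tangent_envelope f (r rho : R) : admissible f -> 0 <= r ->
  exists g, [/\ admissible g, forall x, conjr c (gradient g x) <= r,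
    forall x, g x <= f x + 1 &
    forall x, conjr c (gradient f x) <= r -> enorm x <= rho -> f x - 1 <= g x].
Proof.
move=> af r0; have [cf lf [df cgf] [b bf]] := af.
have [s [sr scov]] := finite_tangents r rho af.
(* The constant [b] makes the family nonempty and the envelope bounded below; its slope 0 has
   conjugate cost at most [0 <= r]. *)
pose L := (0, b) :: [seq (gradient f y, f y - dotp (gradient f y) y) | y <- s].
pose vb (i : 'I_(size s).+1) := nth (0, b) L i.
have vbL i : vb i \in L.
  by apply: mem_nth; rewrite /= size_map; exact: ltn_ord.
have LP u : u \in L -> conjr c u.1 <= r /\ forall x, dotp u.1 x + u.2 <= f x.
  rewrite inE => /orP[/eqP ->|/mapP [y ys ->]] /=; split => [|x].
  - exact: le_trans conjr_at0 r0.
  - by rewrite -(scale0r x) dotpZl mul0r add0r.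
  - exact: sr.
  - by have := convex_tangent cf df y x; rewrite dotpDr dotpNr; lra.
(* Large enough that the smooth maximum of these [(size s).+1] functions exceeds the true one by at
   most 1. *)
pose beta : R := 1 + ln (size s).+1%:R.
have ln0 : 0 <= ln (size s).+1%:R :> R by rewrite ln_ge0// ler1n.
have beta0 : 0 < beta by rewrite /beta; lra.
pose g := softmax (fun i => (vb i).1) (fun i => (vb i).2) beta.
have affg u x : u \in L -> dotp u.1 x + u.2 <= g x.
  move=> uL; have uLs : (index u L < (size s).+1)%N by rewrite -[X in (_ < X.+1)%N](size_map (fun y => (gradient f y, f y - dotp (gradient f y) y))) index_mem.
  have := @aff_le_softmax R d _ (fun i => (vb i).1) (fun i => (vb i).2) beta beta0 (Ordinal uLs) x.
  by rewrite /aff /vb /= nth_index.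
exists g; split.
- split.
  + exact: softmax_convex.
  + exact: softmax_lipschitz.
  + exact: softmax_C1.
  + by exists b => x; have := affg (0, b) x; rewrite inE eqxx -(scale0r x) dotpZl mul0r add0r; apply.
- move=> x; rewrite gradient_softmax//; apply: conjr_sum_le => // [i||i].
  + exact: softw_ge0.
  + exact: sum_softw.
  + exact: (LP _ (vbL i)).1.
- move=> x; apply: le_trans (@softmax_le_max _ _ _ _ _ _ beta0 x (f x) _) _.
    by move=> i; exact: (LP _ (vbL i)).2.
  by rewrite lerD2l ler_pdivrMl// mulr1 /beta; lra.
move=> x xr xrho; have [y ys] := scov x xr xrho.
move/le_trans; apply.
have := affg (gradient f y, f y - dotp (gradient f y) y) x.
rewrite inE map_f ?orbT//= => /(_ isT).
by rewrite dotpDr dotpNr; lra.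
Qed.

End TangentEnvelope.

(** As [2 <= p], the power [p] contracts at least as fast as the square on [0, 1]. *)
Lemma wcost_contract {R : realType} {d : nat} (p eta : R) (z : 'rV[R]_d) :
  2 <= p -> 0 <= eta <= 1 -> wcost p (eta *: z) <= eta ^+ 2 * wcost p z.
Proof.
move=> p2 /andP[e0 e1]; rewrite /wcost enormZ ger0_norm// mulrDr exprMn lerD2l.
rewrite powRM ?enorm_ge0// ler_wpM2r ?powR_ge0// -powR_mulrn//.
have [->|en0] := eqVneq eta 0.
  by rewrite powR0 ?powR_ge0//; apply/eqP; lra.
by apply: ger_powR => //; rewrite lt0r en0 e0 e1.
Qed.

(** * Comparison of exponential integrals under two members of the family *)

Section PairEstimate.
Context {R : realType} {d : nat}.
Notation E := (borel_rV R d).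
Variables (c : 'rV[R]_d -> R) (p alpha C D K : R).
Hypothesis fin : forall v, conjugate c v \is a fin_num.
Hypothesis c_ge0 : forall x, 0 <= c x.
Hypothesis cs0 : forall v, 0 <= conjr c v.
Hypotheses (p2 : 2 <= p) (alpha1 : 1 < alpha) (C0 : 0 < C) (D0 : 0 <= D) (K0 : 0 <= K).
Hypothesis cw : forall x, c x <= K * wcost p x.
Hypothesis scale : forall v s, 0 <= s <= 1 ->
  conjr c (s *: v) <= s `^ alpha * conjr c v.
Variables mu mu' : {measure set E -> \bar R}.
Hypotheses (mu1 : mu setT = 1%E) (mu'1 : mu' setT = 1%E).
Hypothesis muexp : forall s, 0 < s -> (\int[mu]_x (expR (s * enorm x))%:E < +oo)%E.
Hypothesis mu'exp : forall s, 0 < s -> (\int[mu']_x (expR (s * enorm x))%:E < +oo)%E.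
Hypothesis mLS : conv_mLS c mu C.
Variable k : R.-pker E ~> E.
Hypothesis kE : forall B, measurable B -> mu' B = (\int[mu]_x k x B)%E.
Hypothesis kD : (\int[mu]_x (wcost p ((x : 'rV[R]_d) - barycenter (k x)))%:E <= D%:E)%E.

(** Real-valued form of [transport_le]: all integrals are finite, and [b] cancels because both
    measures have mass 1. *)
Lemma transport_Rintegral (phi Rf : E -> R) (v : 'rV[R]_d -> 'rV[R]_d) (b kappa : R) :
  subexp phi -> (forall x, b <= phi x) ->
  (forall x y : 'rV[R]_d, phi x + dotp (v x) (y - x) <= phi y) ->
  subexp Rf -> (forall x, 0 <= Rf x) -> 0 <= kappa ->
  (forall x z, dotp (v x) z <= Rf x + kappa * wcost p z) ->
  (\int[mu]_x phi x <= \int[mu']_x phi x + \int[mu]_x Rf x + kappa * D)%R.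
Proof.
move=> sphi bphi tphi sR R0 kappa0 young.
have sb : subexp (fun x : E => phi x - b) by apply: subexpB => //; exact: subexp_cst.
have enorm_fin : (\int[mu']_x (enorm x)%:E < +oo)%E.
  by apply: integrable_lty => //; apply: subexp_integrable => //; exact: subexp_enorm.
have := transport_le kE enorm_fin sphi.1 bphi tphi sR.1 R0 kappa0 young kD.
rewrite (subexp_integralE muexp sb) (subexp_integralE mu'exp sb).
rewrite (subexp_integralE muexp sR) -!EFinD lee_fin.
rewrite !subexp_RintegralB//; try exact: subexp_cst.
rewrite !Rintegral_cst1//; lra.
Qed.

Variable f : 'rV[R]_d -> R.
Hypothesis af : admissible f.
Variable r : R.
Hypothesis fr : forall x, conjr c (gradient f x) <= r.

Let F := (\int[mu]_x expR (f x))%R.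
Let F' := (\int[mu']_x expR (f x))%R.
Let J := (\int[mu]_x (conjr c (gradient f x) * expR (f x)))%R.

Let mf := admissible_measurable af.
Let sf := admissible_sublinear af.
Let hf := subexp_sublinear mf sf.
Let he := subexp_expR mf sf.
Let hcs := subexp_conjr_gradient fin cs0 af fr.
Let hJ := subexpM hcs he.
Let F0 : 0 < F. Proof. exact: Rintegral_expR_gt0. Qed.
Let F'0 : 0 < F'. Proof. exact: Rintegral_expR_gt0. Qed.

Lemma fenchel_young_wcost x v : dotp v x <= conjr c v + K * wcost p x.
Proof.
rewrite dotpC; apply: le_trans (fenchel_young fin x v) _.
by rewrite lerD2l.
Qed.

(** With [g] the tangent envelope at level [4 * j], the chain is: [ln F] is at most [ln G + 2];
    Herbst compares [ln G] with the mean of [g] under [mu]; transport passes to the mean under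
    [mu'], at cost [4 * j + K * D]; that mean is at most [ln F' + 1], by [g <= f + 1] and Jensen. *)
Lemma ln_ratio_le j : 0 < j -> J <= j * F ->
  ln F - ln F' <= 3 + K * D + 4 * (C / (1 - 2 `^ (1 - alpha)) + 1) * j.
Proof.
move=> j0 hj.
have hN : subexp (fun x : E => enorm x * expR (f x)) by apply: subexpM => //; exact: subexp_enorm.
set N := (\int[mu]_x (enorm x * expR (f x)))%R.
have N0 : 0 <= N by apply: Rintegral_ge0 => x _; rewrite mulr_ge0 ?enorm_ge0 ?expR_ge0.
(* By Markov's inequality at most a quarter of the mass of [expR f] lies outside this ball; the
   [+ 1] keeps [rho] positive. The properties of [g] used afterwards do not involve [rho]. *)
pose rho := 4 * N / F + 1.
have rho0 : 0 < rho by rewrite ltr_wpDl// divr_ge0// ?mulr_ge0// ltW.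
have j40 : 0 < 4 * j by rewrite mulr_gt0.
have [g [ag gr gf fg]] := tangent_envelope fin c_ge0 rho af (ltW j40).
have mg := admissible_measurable ag; have sg := admissible_sublinear ag.
have hg := subexp_sublinear mg sg; have heg := subexp_expR mg sg.
have [cg _ Cg [b bg]] := ag.
set G := (\int[mu]_x expR (g x))%R.
have G0 : 0 < G by exact: Rintegral_expR_gt0.
(* Three cases: where the gradient cost is at most [4 * j] and the norm at most [rho], [f <= g + 1];
   the two exceptional sets are charged to [J] and [N]. *)
have FG : F <= expR 1 * G + (4 * j)^-1 * J + rho^-1 * N.
  rewrite -(subexp_RintegralZ muexp (expR 1) heg) -(subexp_RintegralZ muexp _ hJ).
  rewrite -(subexp_RintegralZ muexp _ hN).
  rewrite -(subexp_RintegralD muexp); try exact: subexpZ.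
  rewrite -(subexp_RintegralD muexp); [|by apply: subexpD; exact: subexpZ|exact: subexpZ].
  apply: (subexp_le_Rintegral muexp) => //.
    by apply: subexpD; [apply: subexpD|]; exact: subexpZ.
  move=> x.
  have e0 := expR_gt0 (f x); have g0 : 0 <= expR 1 * expR (g x) by rewrite mulr_ge0 ?expR_ge0.
  have c0 : 0 <= (4 * j)^-1 * (conjr c (gradient f x) * expR (f x)).
    by rewrite !mulr_ge0 ?invr_ge0 ?(ltW j40) ?(ltW e0).
  have n0 : 0 <= rho^-1 * (enorm x * expR (f x)).
    by rewrite !mulr_ge0 ?invr_ge0 ?(ltW rho0) ?(ltW e0)// enorm_ge0.
  have [xc|xc] := leP (conjr c (gradient f x)) (4 * j); last first.
    apply: le_trans (_ : (4 * j)^-1 * (conjr c (gradient f x) * expR (f x)) <= _).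
      by rewrite mulrA ler_peMl ?(ltW e0)// ler_pdivlMl// mulr1 ltW.
    by rewrite -addrA addrCA lerDl addr_ge0.
  have [xn|xn] := leP (enorm x) rho; last first.
    apply: le_trans (_ : rho^-1 * (enorm x * expR (f x)) <= _).
      by rewrite mulrA ler_peMl ?(ltW e0)// ler_pdivlMl// mulr1 ltW.
    by rewrite lerDr addr_ge0.
  rewrite -addrA; apply: le_trans (_ : expR 1 * expR (g x) <= _).
    by rewrite -expRD ler_expR addrC -lerBlDr fg.
  by rewrite lerDl addr_ge0.
have JF : (4 * j)^-1 * J <= F / 4.
  by rewrite ler_pdivrMl// mulrCA; apply: le_trans hj _; lra.
have NF : rho^-1 * N <= F / 4.
  rewrite ler_pdivrMl// /rho mulrDl mul1r -[leLHS]addr0 lerD//; last first.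
    by rewrite divr_ge0// ltW.
  by have -> : 4 * N / F * (F / 4) = N by field; rewrite gt_eqF.
have GF : F <= 2 * expR 1 * G by lra.
(* The factor [2 * expR 1] costs [ln 2 + 1], which is at most 2. *)
have lnFG : ln F - 2 <= ln G.
  have e1 := expR_gt0 (1 : R).
  have : ln F <= ln (2 * expR 1 * G) by rewrite ler_ln// posrE !mulr_gt0.
  rewrite !lnM ?posrE ?mulr_gt0// expRK.
  have := @le_ln_sub1 R 2 (ltr0n _ 2).
  move: (ln G) (ln F) (ln 2) => lG lF l2; lra.
have gm : (\int[mu']_x g x <= \int[mu']_x f x + 1)%R.
  rewrite -[X in _ <= _ + X](Rintegral_cst1 mu'1) -(subexp_RintegralD mu'exp)//; last exact: subexp_cst.
  by apply: (subexp_le_Rintegral mu'exp) => //; apply: subexpD => //; exact: subexp_cst.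
have fF' : (\int[mu']_x f x <= ln F')%R.
  by rewrite -[leLHS]expRK ler_ln ?posrE ?expR_gt0//; exact: expR_Rintegral_le.
have tr := @transport_Rintegral g (fun=> 4 * j) (gradient g) b K hg bg
  (convex_tangent cg Cg.1) (subexp_cst _) (fun=> ltW j40) K0.
have {}tr := tr (fun x z => le_trans (fenchel_young_wcost z (gradient g x)) _).
have {}tr : (\int[mu]_x g x <= \int[mu']_x g x + 4 * j + K * D)%R.
  rewrite -[X in _ + X + _](Rintegral_cst1 mu1); apply: tr => x z.
  by rewrite lerD2r.
have hb := herbst fin cs0 mu1 muexp C0 mLS ag gr (ltW j40) alpha1 scale.
rewrite -/G in hb.
move: lnFG gm fF' tr hb; move: (1 - 2 `^ (1 - alpha))^-1 => B.
move: (\int[mu']_x g x)%R (\int[mu']_x f x)%R (\int[mu]_x g x)%R => X Y Z.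
move: (ln G) (ln F) (ln F') => lG lF lF'; lra.
Qed.

(** The function [phi], a truncation of the normalized square root [Y] of [expR f], has mean at
    least [1 - C * l / 2] under [mu] by the log-Sobolev inequality, and at most [(1 + F' / F) / 2]
    under [mu']. Transport compares the two means up to [l + K * l * D / 4]. *)
Lemma ratio_ge (l : R) : 0 < l <= 1 -> J <= l ^+ 2 * F ->
  1 - l * (C + 2 + K * D) <= F' / F.
Proof.
move=> /andP[l0 l1] hj.
pose u x := 2^-1 * f x - ln F / 2; pose Y x := expR (u x).
have YE x : Y x = expR (- (ln F / 2)) * expR (2^-1 * f x) by rewrite -expRD addrC.
have ah := @admissibleZ _ _ f 2^-1 (ltW (_ : 0 < 2^-1)) af.
have Y2 x : Y x ^+ 2 = F^-1 * expR (f x).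
  rewrite expr2 -expRD /u -[F^-1]lnK ?posrE ?invr_gt0// -expRD lnV ?posrE//.
  by congr expR; field.
have sY : subexp (Y : E -> R).
  rewrite (_ : Y = fun x => expR (- (ln F / 2)) * expR (2^-1 * f x)); last exact/funext.
  apply: subexpZ; apply: subexp_expR; last exact/sublinearZ.
  exact: measurable_funM.
pose phi x := Num.max (Y x) 2^-1.
have sphi : subexp (phi : E -> R).
  apply: (@subexp_dominated _ _ _ (fun x => Y x + 2^-1)).
  - exact: measurable_maxr sY.1 (measurable_cst _).
  - move=> x; rewrite ger0_norm; last by rewrite le_max invr_ge0 ler0n orbT.
    by rewrite ge_max lerDl lerDr invr_ge0 ler0n expR_ge0.
  - by apply: subexpD => //; exact: subexp_cst.
(* [y x *: gradient f x] is a subgradient of [phi]: the weight vanishes where the truncation at 1/2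
   is active. *)
pose y x := if 2^-1 <= Y x then Y x / 2 else 0.
have [cf lf [df cgf] _] := af.
have tphi x z : phi x + dotp (y x *: gradient f x) (z - x) <= phi z.
  rewrite dotpZl /y /phi; case: ifPn => [Yx|Yx]; last first.
    by rewrite mul0r addr0 max_r ?le_max ?lexx ?orbT// ltW// ltNge.
  rewrite max_l// le_max; apply/orP; left.
  have -> : Y z = Y x * expR ((f z - f x) / 2).
    by rewrite -expRD; congr expR; rewrite /u; field.
  apply: le_trans (_ : Y x * (1 + (f z - f x) / 2) <= _); last first.
    by rewrite ler_wpM2l ?expR_ge0// expR_ge1Dx.
  have := convex_tangent cf df x z; have := expR_gt0 (u x); rewrite -/(Y x).
  move: (dotp _ _) (Y x) (f x) (f z) => dd Yx0 fx fz; nra.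
pose Rf x := l^-1 * (F^-1 * (conjr c (gradient f x) * expR (f x))).
have sRf : subexp (Rf : E -> R) by do 2 apply: subexpZ.
have l'0 : 0 <= l^-1 by rewrite invr_ge0 ltW.
have Rf0 x : 0 <= Rf x.
  by rewrite !mulr_ge0// ?invr_ge0 ?expR_ge0// ltW.
have young x z : dotp (y x *: gradient f x) z <= Rf x + K * l / 4 * wcost p z.
  have w0 : 0 <= wcost p z by rewrite addr_ge0 ?powR_ge0// sqr_ge0.
  have kw : 0 <= K * l / 4 * wcost p z by rewrite !mulr_ge0// ?ltW.
  rewrite dotpZl /y; case: ifPn => [Yx|_]; last by rewrite mul0r addr_ge0.
  have Y0 : 0 < Y x by exact: expR_gt0.
  (* Since [Y x] is at least 1/2 and [l] at most 1, [eta <= 1] and [wcost] contracts quadratically.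
     The prefactor [Y x / 2 / eta] equals [Y x ^+ 2 / l], so the conjugate term becomes [Rf x] and
     the cost term carries [K * l / 4]. *)
  pose eta := l / (2 * Y x).
  have eta0 : 0 < eta by rewrite divr_gt0// mulr_gt0.
  have eta1 : eta <= 1.
    rewrite ler_pdivrMr ?mulr_gt0// mul1r; apply: le_trans l1 _.
    by rewrite -ler_pdivrMl// mulr1.
  have := fenchel_young_wcost (eta *: z) (gradient f x); rewrite dotpZr => h.
  have {h}h : eta * dotp (gradient f x) z <=
      conjr c (gradient f x) + K * (eta ^+ 2 * wcost p z).
    by apply: le_trans h _; rewrite lerD2l ler_wpM2l// wcost_contract// eta1 ltW.
  have -> : Rf x = Y x ^+ 2 * conjr c (gradient f x) / l by rewrite /Rf Y2; ring.
  have -> : K * l / 4 * wcost p z = Y x / 2 / eta * (K * (eta ^+ 2 * wcost p z)).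
    by rewrite /eta; field; rewrite !gt_eqF.
  have -> : Y x ^+ 2 * conjr c (gradient f x) / l = Y x / 2 / eta * conjr c (gradient f x).
    by rewrite /eta; field; rewrite !gt_eqF.
  have -> : Y x / 2 * dotp (gradient f x) z = Y x / 2 / eta * (eta * dotp (gradient f x) z).
    by field; rewrite gt_eqF.
  by rewrite -mulrDr ler_wpM2l// (divr_ge0 (divr_ge0 (ltW Y0) (ler0n _ 2)) (ltW eta0)).
have phi2 x : 2^-1 <= phi x by rewrite le_max lexx orbT.
have kap0 : 0 <= K * l / 4 by rewrite !mulr_ge0// ltW.
have tr := transport_Rintegral sphi phi2 tphi sRf Rf0 kap0 young.
have RfE : (\int[mu]_x Rf x = l^-1 * (F^-1 * J))%R.
  rewrite (subexp_RintegralZ muexp); last exact: subexpZ.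
  by rewrite (subexp_RintegralZ muexp).
have RfJ : l^-1 * (F^-1 * J) <= l.
  by rewrite ler_pdivrMl// ler_pdivrMl// [leRHS]mulrC -expr2.
(* Pointwise, [Y <= (1 + Y ^+ 2) / 2], and [Y ^+ 2] is [expR f] divided by [F]. *)
have up : (\int[mu']_x phi x <= 2^-1 + 2^-1 * (F' / F))%R.
  rewrite -[X in _ <= X + _](Rintegral_cst1 mu'1) [F' / F]mulrC mulrA.
  rewrite -(subexp_RintegralZ mu'exp _ he) -(subexp_RintegralD mu'exp); last 2 first.
  - exact: subexp_cst.
  - exact: subexpZ.
  apply: (subexp_le_Rintegral mu'exp) => //.
    by apply: subexpD; [exact: subexp_cst|exact: subexpZ].
  move=> x; rewrite -mulrA -Y2 ge_max; apply/andP; split; last first.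
    by rewrite lerDl mulr_ge0// ?invr_ge0// sqr_ge0.
  by have := sqr_ge0 (Y x - 1); rewrite expr2; move: (Y x) => t; nra.
(* From [expR u >= expR (2 * u) * (1 - u)]: the integral of the right side is 1 minus half the
   normalized entropy, which is at most [C * l] because [l ^+ 2 <= l]. *)
have low : 1 - C * l / 2 <= (\int[mu]_x phi x)%R.
  have sfe : subexp (fun x : E => f x * expR (f x)) by exact: subexpM.
  apply: le_trans (_ : (\int[mu]_x (F^-1 * (1 + ln F / 2) * expR (f x)
     - F^-1 / 2 * (f x * expR (f x))))%R <= _); last first.
    apply: (subexp_le_Rintegral muexp) => //; first by apply: subexpB; exact: subexpZ.
    move=> x; rewrite le_max; apply/orP; left.
    have := expR_ge1Dx (- u x); rewrite -(ler_pM2l (exprn_gt0 2 (expR_gt0 (u x)))).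
    rewrite -/(Y x) {2}expr2 -mulrA /Y -expRD subrr expR0 mulr1 -/(Y x) Y2.
    by apply: le_trans; rewrite /u; move: (f x) (expR _) (F^-1) (ln F) => a1 a2 a3 a4; lra.
  rewrite (subexp_RintegralB muexp); try exact: subexpZ.
  rewrite !(subexp_RintegralZ muexp)//.
  have := mLS_Rintegral fin cs0 mu1 muexp mLS af fr; rewrite -/F -/J.
  set N := (\int[mu]_x _)%R => h.
  have hF : N - F * ln F <= C * (l * F).
    apply: le_trans h _; rewrite ler_wpM2l ?(ltW C0)//; apply: le_trans hj _.
    by rewrite ler_wpM2r ?(ltW F0)// expr2 ler_piMr// ltW.
  have -> : F^-1 * (1 + ln F / 2) * F - F^-1 / 2 * N = 1 - (N - F * ln F) / (2 * F).
    by field; rewrite gt_eqF.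
  rewrite lerD2l lerN2 ler_pdivrMr ?mulr_gt0//.
  have -> : C * l / 2 * (2 * F) = C * (l * F) by field.
  by [].
have lKD : 0 <= l * (K * D) by rewrite !mulr_ge0// ltW.
move: tr; rewrite RfE => tr.
move: lKD RfJ tr up low; move: (F' / F) (\int[mu]_x phi x)%R (\int[mu']_x phi x)%R (l^-1 * _).
move=> q a1 a2 a3; lra.
Qed.

End PairEstimate.

(* [Q + S * j] bounds the logarithmic ratio when [j] is large, [1 - l * P] the
   ratio when [j = l ^+ 2] is small; the threshold is [l * P = 1 / 2]. *)
Lemma covariance_ln_le {R : realType} (F F' J P Q S : R) :
  0 < F' -> F' <= F -> 0 <= J -> 2 <= P -> 3 <= Q -> 0 <= S ->
  (forall j, 0 < j -> J <= j * F -> ln F - ln F' <= Q + S * j) ->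
  (forall l, 0 < l <= 1 -> J <= l ^+ 2 * F -> 1 - l * P <= F' / F) ->
  (F - F') * (ln F - ln F') <= (4 * P ^+ 2 * Q + S) * J.
Proof.
move=> F'0 F'F J0 P2 Q3 S0 large small.
have F0 : 0 < F by exact: lt_le_trans F'F.
have lnF0 : 0 <= ln F - ln F' by rewrite subr_ge0 ler_ln.
set C2 := 4 * P ^+ 2 * Q + S.
have P20 : 4 <= P ^+ 2.
  have -> : 4 = 2 ^+ 2 :> R by ring.
  by rewrite ler_pXn2r// nnegrE; lra.
have C20 : 0 < C2.
  rewrite /C2; have : 0 < 4 * P ^+ 2 * Q by rewrite !mulr_gt0//; lra.
  lra.
(* Both hypotheses need a positive parameter while [J] may vanish: apply this with a slack [e / C2]
   added to [J] and let [e] tend to 0. *)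
suff key j : 0 < j -> J <= j * F -> (F - F') * (ln F - ln F') <= C2 * (j * F).
  apply/ler_addgt0Pr => e e0.
  have eC : 0 < e / C2 by exact: divr_gt0.
  apply: le_trans (key ((J + e / C2) / F) _ _) _.
  - by rewrite divr_gt0//; lra.
  - by rewrite divfK ?gt_eqF//; lra.
  by rewrite divfK ?gt_eqF// mulrDr [C2 * (e / _)]mulrC divfK// gt_eqF.
move=> j0 hj; pose l := Num.sqrt j.
have l0 : 0 < l by rewrite sqrtr_gt0.
have l2 : l ^+ 2 = j by rewrite sqr_sqrtr// ltW.
have FF : F - F' <= F by rewrite gerBl ltW.
have [lP|lP] := leP (l * P) (1 / 2); last first.
  (* Allows the additive constant [Q] to be absorbed into a multiple of [j]. *)
  have jP : 1 <= 4 * P ^+ 2 * j.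
    have : (1 / 2) ^+ 2 <= (l * P) ^+ 2 by rewrite ler_pXn2r// ?nnegrE; lra.
    rewrite [(l * P) ^+ 2]exprMn l2 => h.
    have -> : 4 * P ^+ 2 * j = 4 * (j * P ^+ 2) by ring.
    have E : (1 / 2) ^+ 2 = 1 / 4 :> R by field.
    by move: h; rewrite E; move: (j * _) => t; lra.
  apply: le_trans (_ : F * (Q + S * j) <= _).
    by apply: ler_pM => //; [rewrite subr_ge0|exact: large].
  have -> : C2 * (j * F) = F * (4 * P ^+ 2 * j * Q + S * j) by rewrite /C2; ring.
  by rewrite ler_wpM2l ?(ltW F0)// lerD2r ler_peMl//; lra.
have l1 : l <= 1.
  have : l * 2 <= l * P by rewrite ler_wpM2l// ltW.
  lra.
have q := small l; rewrite l0 l1 l2 in q; have {}q := q isT hj.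
set q0 := F' / F in q.
have F'E : F' = q0 * F by rewrite /q0 divfK// gt_eqF.
have q00 : 0 < q0 by exact: divr_gt0.
have q01 : q0 <= 1 by rewrite ler_pdivrMr// mul1r.
have qh : 1 / 2 <= q0 by lra.
have lnE : ln F - ln F' = ln q0^-1.
  by rewrite F'E lnM ?posrE// lnV ?posrE// opprD addrCA subrr addr0.
(* From [-ln q0 <= 1 / q0 - 1] with [q0] at least 1/2. Both factors of the product are thus of order
   [l], so the product is of order [l ^+ 2 = j]. *)
have lnq : ln F - ln F' <= 2 * (l * P).
  rewrite lnE; have := @le_ln_sub1 R q0^-1; rewrite invr_gt0 => /(_ q00) h.
  apply: le_trans h _; rewrite lerBlDr -[leLHS]mul1r ler_pdivrMr//; nra.
apply: le_trans (_ : (F * (l * P)) * (2 * (l * P)) <= _).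
  apply: ler_pM => //; first by rewrite subr_ge0.
  rewrite F'E; have -> : F - q0 * F = F * (1 - q0) by ring.
  by rewrite ler_wpM2l ?(ltW F0)//; lra.
have -> : (F * (l * P)) * (2 * (l * P)) = 2 * P ^+ 2 * (l ^+ 2 * F) by ring.
rewrite l2 ler_wpM2r ?mulr_ge0 ?(ltW j0) ?(ltW F0)// /C2.
have : 0 <= P ^+ 2 * (Q - 1) by rewrite mulr_ge0//; lra.
move: (P ^+ 2) P20 => P2'; nra.
Qed.

(** * Entropy over the mixing measure *)

Section ProbabilityEntropy.
Context {dT} {T : measurableType dT} {R : realType}.
Variable m : probability T R.

Lemma bounded_integrable (g : T -> R) M : measurable_fun setT g ->
  (forall t, `|g t| <= M) -> m.-integrable setT (EFin \o g).
Proof.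
move=> mg gM; apply: (@le_integrable _ _ _ m _ measurableT _ (EFin \o cst M)).
- exact/measurable_EFinP.
- by move=> t _; rewrite /= lee_fin; apply: le_trans (gM t) (ler_norm _).
- exact: finite_measure_integrable_cst.
Qed.

(** Integrating [pair] in both variables bounds twice the covariance of [F] and [ln F]; Jensen's
    inequality for the logarithm shows that the entropy is at most this covariance. The variables
    are integrated one after the other, so no product measure is used. *)
Lemma entropy_le_covariance (F J : T -> R) (lo hi Jhi C2 : R) :
  measurable_fun setT F -> measurable_fun setT J ->
  0 < lo -> (forall t, lo <= F t <= hi) -> (forall t, 0 <= J t <= Jhi) ->
  (forall t t', (F t - F t') * (ln (F t) - ln (F t')) <= C2 * (J t + J t')) ->
  (\int[m]_t (F t * ln (F t)) - \int[m]_t F t * ln (\int[m]_t F t) <=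
   C2 * \int[m]_t J t)%R.
Proof.
move=> mF mJ lo0 Fb Jb pair.
have F0 t : 0 < F t by have /andP[+ _] := Fb t; exact: lt_le_trans.
have mln : measurable_fun setT (fun t => ln (F t)).
  by apply: measurableT_comp => //; exact: measurable_ln.
have lnb t : `|ln (F t)| <= `|ln lo| + `|ln hi|.
  have /andP[h1 h2] := Fb t.
  have hi0 : 0 < hi by exact: lt_le_trans (F0 t) h2.
  have : ln lo <= ln (F t) by rewrite ler_ln ?posrE.
  have : ln (F t) <= ln hi by rewrite ler_ln ?posrE.
  move=> a1 a2; rewrite ler_norml; apply/andP; split.
    have := ler_norm (- ln lo); rewrite normrN; have := normr_ge0 (ln hi); lra.
  have := ler_norm (ln hi); have := normr_ge0 (ln lo); lra.
have iF : m.-integrable setT (EFin \o F).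
  apply: (@bounded_integrable _ hi) => // t.
  by rewrite gtr0_norm//; have /andP[] := Fb t.
have iJ : m.-integrable setT (EFin \o J).
  by apply: (@bounded_integrable _ Jhi) => // t; have /andP[? ?] := Jb t; rewrite ger0_norm.
have il : m.-integrable setT (EFin \o (fun t => ln (F t))).
  exact: (@bounded_integrable _ (`|ln lo| + `|ln hi|)).
have iFl : m.-integrable setT (EFin \o (fun t => F t * ln (F t))).
  apply: (@bounded_integrable _ (hi * (`|ln lo| + `|ln hi|))).
    exact: measurable_funM.
  move=> t; rewrite normrM ler_pM// gtr0_norm//; by have /andP[] := Fb t.
have ic r : m.-integrable setT (EFin \o (fun _ : T => r)).
  exact: finite_measure_integrable_cst.
have iZ (g : T -> R) r : m.-integrable setT (EFin \o g) ->
    m.-integrable setT (EFin \o (fun t => r * g t)) by exact: integrableZl.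
have iD (g h : T -> R) : m.-integrable setT (EFin \o g) ->
    m.-integrable setT (EFin \o h) -> m.-integrable setT (EFin \o (fun t => g t + h t)).
  exact: integrableD.
have icst r : (\int[m]_t r = r)%R.
  by rewrite Rintegral_cst// [X in fine X](_ : _ = 1%E) ?mulr1//; exact: probability_setT.
set A := (\int[m]_t (F t * ln (F t)))%R; set Fb_ := (\int[m]_t F t)%R.
set Jb_ := (\int[m]_t J t)%R; pose L := (\int[m]_t ln (F t))%R.
(* Integrating in [t] with [t'] frozen, and then in [t'], only produces combinations of this
   shape. *)
have comb x y z w :
    m.-integrable setT (EFin \o (fun t => x * (F t * ln (F t)) + y * ln (F t) + z * F t + w)) /\
    (\int[m]_t (x * (F t * ln (F t)) + y * ln (F t) + z * F t + w))%R =
    x * A + y * L + z * Fb_ + w.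
  have i1 := iZ _ x iFl; have i2 := iZ _ y il; have i3 := iZ _ z iF.
  have i12 := iD _ _ i1 i2; have i123 := iD _ _ i12 i3.
  split; first exact: iD _ _ i123 (ic w).
  by rewrite RintegralD// RintegralD// RintegralD// icst !RintegralZl.
have combJ x w : m.-integrable setT (EFin \o (fun t => x * J t + w)) /\
    (\int[m]_t (x * J t + w))%R = x * Jb_ + w.
  have i1 := iZ _ x iJ; split; first exact: iD _ _ i1 (ic w).
  by rewrite RintegralD// icst RintegralZl.
have step t' : 1 * A + - F t' * L + - ln (F t') * Fb_ + F t' * ln (F t') <=
    C2 * Jb_ + C2 * J t'.
  rewrite -(comb _ _ _ _).2 -(combJ _ _).2; apply: le_Rintegral => //.
  - exact: (comb _ _ _ _).1.
  - exact: (combJ _ _).1.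
  - move=> t _; have := pair t t'; rewrite mulrDr.
    by move: (ln (F t)) (ln (F t')) => x y; lra.
have : 1 * A + - Fb_ * L + - L * Fb_ + A <= C2 * Jb_ + C2 * Jb_.
  rewrite -(comb 1 (- Fb_) (- L) A).2 -(combJ _ _).2.
  apply: le_Rintegral => //.
  - exact: (comb _ _ _ _).1.
  - exact: (combJ _ _).1.
  - by move=> t _; have := step t; move: (ln (F t)) => x; lra.
have Fb0 : 0 < Fb_.
  apply: lt_le_trans lo0 _; rewrite -[leLHS]icst.
  by apply: le_Rintegral => // t _; have /andP[] := Fb t.
(* Integrates [ln u <= u - 1] at [u = F t / Fb_]. *)
have Lle : L <= ln Fb_.
  have -> : ln Fb_ = (\int[m]_t (ln Fb_ - 1 + Fb_^-1 * F t))%R.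
    rewrite RintegralD//; last exact: iZ.
    by rewrite RintegralZl// icst -/Fb_ mulVf ?gt_eqF// subrK.
  apply: le_Rintegral => //; first by apply: iD => //; exact: iZ.
  move=> t _; have := @le_ln_sub1 R (Fb_^-1 * F t).
  rewrite mulr_gt0 ?invr_gt0// => /(_ isT).
  rewrite lnM ?posrE ?invr_gt0// lnV ?posrE//.
  by move: (ln _) (ln _) (_ * _) => x y z; lra.
have := ler_wpM2l (ltW Fb0) Lle.
by move: (ln Fb_) => x; lra.
Qed.

End ProbabilityEntropy.

(** The leading [C] comes from averaging the individual entropies. The rest is [4 * P ^+ 2 * Q + S]
    of [covariance_ln_le], with [P = C + 2 + K * D] from [ratio_ge], and [Q = 3 + K * D] and the
    slope [S] from [ln_ratio_le] at [alpha = A / (A - 1)]. *)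
Definition mixture_constant {R : realType} (C D A K : R) : R :=
  C + (4 * (C + 2 + K * D) ^+ 2 * (3 + K * D) +
       4 * (C / (1 - 2 `^ (1 - A / (A - 1))) + 1)).

Lemma probability_inhabited {dT} {T : measurableType dT} {R : realType}
  (m : probability T R) : exists t : T, True.
Proof.
apply: contrapT => h; have := probability_setT m.
rewrite (_ : setT = set0) ?measure0; last first.
  by apply/seteqP; split => t // _; apply: h; exists t.
by move=> /eqP; rewrite eq_sym onee_eq0.
Qed.

(** * The log-Sobolev inequality for the mixture *)

Section Mixture.
Context {R : realType} {d : nat}.
Notation E := (borel_rV R d).
Variables (c : 'rV[R]_d -> R) (p A C D K : R).
Hypothesis fin : forall v, conjugate c v \is a fin_num.
Hypothesis conj_bd : forall M, exists r : R, forall v, enorm v <= M -> conjr c v <= r.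
Hypothesis c_ge0 : forall x, 0 <= c x.
Hypothesis cs0 : forall v, 0 <= conjr c v.
Hypotheses (p2 : 2 <= p) (A1 : 1 < A) (C0 : 0 < C) (D0 : 0 <= D) (K0 : 0 <= K).
Hypothesis cw : forall x, c x <= K * wcost p x.
Hypothesis scale : forall v s, 0 <= s <= 1 ->
  conjr c (s *: v) <= s `^ (A / (A - 1)) * conjr c v.
Context {dT : measure_display} {T : measurableType dT}.
Variables (m : probability T R) (mu : R.-pker T ~> E).
Hypothesis muexp : forall t s, 0 < s -> (\int[mu t]_x (expR (s * enorm x))%:E < +oo)%E.
Hypothesis mLS : forall t, conv_mLS c (mu t) C.
Hypothesis transport : forall t t', exists k : R.-pker E ~> E,
  (forall B, measurable B -> mu t' B = (\int[mu t]_x k x B)%E) /\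
  (\int[mu t]_x (wcost p ((x : 'rV[R]_d) - barycenter (k x)))%:E <= D%:E)%E.

Let alpha := A / (A - 1).
Let alpha1 : 1 < alpha.
Proof. by rewrite /alpha ltr_pdivlMr ?subr_gt0// mul1r gtrBl. Qed.

Let S := 4 * (C / (1 - 2 `^ (1 - alpha)) + 1).
Let S0 : 0 <= S.
Proof.
rewrite mulr_ge0// addr_ge0// divr_ge0 ?(ltW C0)// subr_ge0.
by rewrite -[leRHS](powRr0 2); apply: ler_powR; rewrite ?ler1n// subr_le0 ltW.
Qed.

Section function.
Variable f : 'rV[R]_d -> R.
Hypothesis af : admissible f.
Variable r : R.
Hypothesis fr : forall x, conjr c (gradient f x) <= r.

Let mf := admissible_measurable af.
Let sf := admissible_sublinear af.
Let hf := subexp_sublinear mf sf.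
Let he := subexp_expR mf sf.
Let hJ := subexpM (subexp_conjr_gradient fin cs0 af fr) he.

Let F t := (\int[mu t]_x expR (f x))%R.
Let J t := (\int[mu t]_x (conjr c (gradient f x) * expR (f x)))%R.
Let N t := (\int[mu t]_x (f x * expR (f x)))%R.

Let mu1 t : mu t setT = 1%E. Proof. exact: prob_kernel. Qed.

Let F0 t : 0 < F t. Proof. exact: (Rintegral_expR_gt0 (mu1 t) (muexp t)). Qed.

Let J0 t : 0 <= J t.
Proof. by apply: Rintegral_ge0 => x _; rewrite mulr_ge0// expR_ge0. Qed.

Lemma mixture_ln_ratio_le t t' j : 0 < j -> J t <= j * F t ->
  ln (F t) - ln (F t') <= 3 + K * D + S * j.
Proof.
have [k [kE kD]] := transport t t'.
exact: (ln_ratio_le fin c_ge0 cs0 alpha1 C0 K0 cw scale (mu1 t) (mu1 t') (muexp t)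
  (muexp t') (mLS t) kE kD af fr).
Qed.

(** The left side is symmetric in [t] and [t'], so the one-sided bound at the index with the larger
    [F] suffices. *)
Lemma mixture_pair t t' :
  (F t - F t') * (ln (F t) - ln (F t')) <=
  (4 * (C + 2 + K * D) ^+ 2 * (3 + K * D) + S) * (J t + J t').
Proof.
have KD : 0 <= K * D by exact: mulr_ge0.
set C2 := _ + S.
have C20 : 0 <= C2.
  apply: addr_ge0 => //; apply: mulr_ge0; last exact: addr_ge0.
  by apply: mulr_ge0 => //; exact: sqr_ge0.
have half s s' : F s' <= F s ->
    (F s - F s') * (ln (F s) - ln (F s')) <= C2 * J s.
  move=> FF; apply: covariance_ln_le => //.
  - by rewrite -addrA addrC -addrA lerDl addr_ge0// ltW.
  - by rewrite lerDl.
  - by move=> j; exact: mixture_ln_ratio_le.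
  - move=> l l01 hj; have [k [kE kD]] := transport s s'.
    exact: (ratio_ge fin cs0 p2 C0 D0 K0 cw (mu1 s) (mu1 s') (muexp s)
    (muexp s') (mLS s) kE kD af fr l01 hj).
rewrite [leRHS]mulrDr; have [FF|FF] := leP (F t') (F t).
  by apply: le_trans (half _ _ FF) _; rewrite lerDl mulr_ge0.
rewrite -mulrNN !opprB; apply: le_trans (half _ _ (ltW FF)) _.
by rewrite lerDr mulr_ge0.
Qed.

Let intE (g : E -> R) t : subexp g -> (\int[mu t]_x (g x)%:E)%E = (\int[mu t]_x g x)%R%:E.
Proof. by move=> sg; exact: (subexp_integralE (muexp t)). Qed.

Let measurable_int (g : E -> R) : subexp g -> (forall x, 0 <= g x) ->
  measurable_fun setT (fun t => (\int[mu t]_x g x)%R).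
Proof.
move=> sg g0; apply: (measurableT_comp (f := @fine R)) => //.
apply: measurable_kernel_integral => [x|]; first by rewrite lee_fin.
by apply/measurable_EFinP; exact: sg.1.
Qed.

Let nu := mixture m mu.

Let nu_integral (g : E -> R) M : subexp g -> (forall x, 0 <= g x) ->
  (forall t, (\int[mu t]_x g x)%R <= M) ->
  m.-integrable setT (EFin \o (fun t => (\int[mu t]_x g x)%R)) /\
  (\int[nu]_x (g x)%:E)%E = (\int[m]_t (\int[mu t]_x g x))%R%:E.
Proof.
move=> sg g0 gM.
have im : m.-integrable setT (EFin \o (fun t => (\int[mu t]_x g x)%R)).
  apply: (@bounded_integrable _ _ _ _ _ M); first exact: measurable_int.
  by move=> t; rewrite ger0_norm//; exact: Rintegral_ge0.
split => //; rewrite (@kernel_integral _ _ _ _ _ m mu) => [|//|x|]; last 2 first.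
- by rewrite lee_fin.
- by apply/measurable_EFinP; exact: sg.1.
rewrite fineK; last exact: integrable_fin_num.
by apply: eq_integral => t _; rewrite intE.
Qed.

Lemma mixture_entropy :
  (Ent nu (fun x => expR (f x)) <= (mixture_constant C D A K)%:E *
    \int[nu]_x (conjugate c (gradient f x) * (expR (f x))%:E))%E.
Proof.
have [t0 _] := probability_inhabited m.
have [_ _ _ [b fb]] := af.
have r0 : 0 <= r by apply: le_trans (fr 0).
have JF t : J t <= (r + 1) * F t.
  rewrite -(subexp_RintegralZ (muexp t) _ he).
  apply: (subexp_le_Rintegral (muexp t)) => //; first exact: subexpZ.
  by move=> x; rewrite ler_wpM2r ?expR_ge0//; apply: le_trans (fr x) _; lra.
(* The crude bound [J <= (r + 1) * F] makes the ratio estimate available with one [j = r + 1] for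
   all pairs. This confines [F] to an interval [[lo, hi]] with [lo > 0], uniformly in [t]; the bound
   depends on [f] and serves only integrability. *)
pose L := 3 + K * D + S * (r + 1).
have lnL t t' : ln (F t) - ln (F t') <= L.
  by apply: mixture_ln_ratio_le => //; lra.
pose hi := expR (ln (F t0) + L); pose lo := expR (ln (F t0) - L).
have Fb t : lo <= F t <= hi.
  rewrite -[F t]lnK ?posrE// !ler_expR.
  by have := lnL t t0; have := lnL t0 t; move: (ln _) (ln _) => x y; lra.
have Jb t : 0 <= J t <= (r + 1) * hi.
  rewrite J0/=; apply: le_trans (JF t) _; rewrite ler_wpM2l//; first by lra.
  by have /andP[] := Fb t.
have e0 x : 0 <= expR (f x) by exact: expR_ge0.
have j0 x : 0 <= conjr c (gradient f x) * expR (f x) by rewrite mulr_ge0.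
have [iF FE] := nu_integral he e0 (fun t => proj2 (andP (Fb t))).
have [iJ JE] := nu_integral hJ j0 (fun t => proj2 (andP (Jb t))).
have lo0 : 0 < lo by exact: expR_gt0.
have hi0 : 0 < hi by exact: expR_gt0.
have lnFb t : `|ln (F t)| <= `|ln lo| + `|ln hi|.
  have /andP[h1 h2] := Fb t; rewrite /lo /hi !expRK.
  rewrite -ler_ln ?posrE// expRK in h1; rewrite -ler_ln ?posrE// expRK in h2.
  have := ler_norm (ln (F t0) + L); have := ler_norm (- (ln (F t0) - L)).
  have := normr_ge0 (ln (F t0) + L); have := normr_ge0 (ln (F t0) - L).
  rewrite normrN ler_norml; move: `|_| `|_| => y z.
  by move: h1 h2; move: (ln _) (ln _) => u v *; apply/andP; split; lra.
have Flnb t : `|F t * ln (F t)| <= hi * (`|ln lo| + `|ln hi|).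
  by rewrite normrM ler_pM// gtr0_norm//; have /andP[] := Fb t.
have mF : measurable_fun setT F by exact: measurable_int.
have mJ : measurable_fun setT J by exact: measurable_int.
have iFln : m.-integrable setT (EFin \o (fun t => F t * ln (F t))).
  apply: bounded_integrable Flnb; apply: measurable_funM => //.
  by apply: measurableT_comp => //; exact: measurable_ln.
have NF t : N t <= F t * ln (F t) + C * J t.
  have := mLS_Rintegral fin cs0 (mu1 t) (muexp t) (mLS t) af fr.
  by rewrite lerBlDl.
have sfe : subexp (fun x : E => f x * expR (f x)) by exact: subexpM.
(* [f * expR f] may change sign; subtracting [b * expR f], with [b] a lower bound of [f], makes it
   nonnegative so that it can be integrated through the kernel. The subtracted term is added back in
   [feE]. *)
pose h (x : E) := f x * expR (f x) - b * expR (f x).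
have sh : subexp h by apply: subexpB => //; exact: subexpZ.
have h0 x : 0 <= h x by rewrite /h -mulrBl mulr_ge0// subr_ge0.
have hE t : (\int[mu t]_x h x = N t - b * F t)%R.
  rewrite (subexp_RintegralB (muexp t))//; last exact: subexpZ.
  by rewrite (subexp_RintegralZ (muexp t)).
have hM t : (\int[mu t]_x h x <=
    hi * (`|ln lo| + `|ln hi|) + C * ((r + 1) * hi) + `|b| * hi)%R.
  rewrite hE; apply: lerD.
    apply: le_trans (NF t) _; apply: lerD.
      exact: le_trans (ler_norm _) (Flnb t).
    by rewrite ler_wpM2l ?(ltW C0)//; have /andP[] := Jb t.
  apply: le_trans (ler_norm _) _; rewrite normrN normrM ler_wpM2l//.
  by rewrite gtr0_norm//; have /andP[] := Fb t.
have [ih hnuE] := nu_integral sh h0 hM.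
have nu_fin (g : E -> R) y : subexp g -> (forall x, 0 <= g x) ->
    (\int[nu]_x (g x)%:E)%E = y%:E -> nu.-integrable setT (EFin \o g).
  move=> sg g0 gy; apply/integrableP; split; first by apply/measurable_EFinP; exact: sg.1.
  under eq_integral do rewrite /= ger0_norm//.
  by rewrite gy ltry.
have inuh := nu_fin _ _ sh h0 hnuE.
have inue := nu_fin _ _ he e0 FE.
have feE : (\int[nu]_x (f x * expR (f x))%:E)%E =
    ((\int[m]_t (N t - b * F t)) + b * (\int[m]_t F t))%R%:E.
  under eq_integral => x _.
    rewrite (_ : f x * expR (f x) = h x + b * expR (f x)); last by rewrite /h subrK.
    rewrite EFinD EFinM; over.
  rewrite integralD//; last exact: integrableZl.
  rewrite integralZl// FE hnuE -EFinM -EFinD; congr (_ + _)%:E.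
  by apply: eq_Rintegral => t _; exact: hE.
have ent := entropy_le_covariance m mF mJ lo0 Fb Jb mixture_pair.
rewrite /Ent; under eq_integral do rewrite expRK mulrC.
under [X in (_ <= _ * X)%E]eq_integral do rewrite conjrE// -EFinM.
have Fbar0 : 0 < (\int[m]_t F t)%R.
  apply: lt_le_trans lo0 _.
  have -> : lo = (\int[m]_t lo)%R.
    by rewrite Rintegral_cst// [X in fine X](_ : _ = 1%E) ?mulr1//; exact: probability_setT.
  apply: le_Rintegral => //; first exact: finite_measure_integrable_cst.
  by move=> t _; have /andP[] := Fb t.
(* All terms are finite, so the dual subtraction in [Ent] is ordinary subtraction. *)
rewrite feE FE JE lne_EFin// -EFinM -EFinM -DualAddTheoryNumDomain.dEFinB lee_fin.
have ihN : m.-integrable setT (EFin \o (fun t => N t - b * F t)).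
  by move: ih; apply: eq_integrable => // t _ /=; rewrite hE.
have ibF : m.-integrable setT (EFin \o (fun t => b * F t)).
  exact: (integrableZl measurableT b iF).
have iCJ : m.-integrable setT (EFin \o (fun t => C * J t)).
  exact: (integrableZl measurableT C iJ).
have Nle : (\int[m]_t (N t - b * F t) + b * \int[m]_t F t <=
    \int[m]_t (F t * ln (F t)) + C * \int[m]_t J t)%R.
  rewrite -(RintegralZl b measurableT iF) -(RintegralZl C measurableT iJ).
  rewrite -(RintegralD measurableT ihN ibF) -(RintegralD measurableT iFln iCJ).
  apply: le_Rintegral => //.
  - exact: (integrableD measurableT ihN ibF).
  - exact: (integrableD measurableT iFln iCJ).
  - by move=> t _; rewrite subrK.
rewrite /mixture_constant mulrDl.
move: ent Nle; rewrite -/alpha -/S.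
move: (\int[m]_t (F t * ln (F t)))%R (_ * \int[m]_t J t)%R => a1 a2.
by move: (_ + b * _) (_ * ln _) (C * _) => a3 a4 a5; lra.
Qed.

End function.

Lemma mixture_mLS : conv_mLS c (mixture m mu) (mixture_constant C D A K).
Proof.
move=> f cf lf Cf bf; have [df _] := Cf.
have [M fM] := gradient_bounded lf df.
have [r Mr] := conj_bd M.
by apply: (@mixture_entropy f _ r) => // x; exact: Mr.
Qed.

Lemma mixture_constant_gt0 : 0 < mixture_constant C D A K.
Proof.
rewrite /mixture_constant -/alpha -/S; apply: ltr_pwDl => //.
apply: addr_ge0 => //; apply: mulr_ge0; last by rewrite addr_ge0// mulr_ge0.
by apply: mulr_ge0 => //; exact: sqr_ge0.
Qed.

End Mixture.

(** * Passing from optimal constants to usable ones, and conclusion *)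

Section Constants.
Context {R : realType} {d : nat}.
Notation E := (borel_rV R d).
Implicit Types (c : 'rV[R]_d -> R) (mu : {measure set E -> \bar R}).

Lemma conv_mLS_le c mu (C C' : R) : (forall v, (0 <= conjugate c v)%E) -> C <= C' ->
  conv_mLS c mu C -> conv_mLS c mu C'.
Proof.
move=> c0 CC h f cf lf Cf bf; apply: le_trans (h f cf lf Cf bf) _.
apply: lee_wpmul2r; last by rewrite lee_fin.
by apply: integral_ge0 => x _; rewrite mule_ge0// lee_fin expR_ge0.
Qed.

Lemma conv_mLS_of_const c mu (C : R) : (forall v, (0 <= conjugate c v)%E) ->
  (conv_mLS_const c mu < C%:E)%E -> conv_mLS c mu C.
Proof.
move=> c0 /ereal_inf_lt [_ [C' [_ h] <-]]; rewrite lte_fin => /ltW CC.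
exact: conv_mLS_le h.
Qed.

Lemma conv_mLS_const_ge0 c mu : (0 <= conv_mLS_const c mu)%E.
Proof. by apply: le_ereal_inf_tmp => _ [C [C0 _] <-]; rewrite lee_fin ltW. Qed.

Lemma weak_transport_ge0 (p : R) mu mu' : (0 <= weak_transport p mu' mu)%E.
Proof.
apply: le_ereal_inf_tmp => _ [pi [k [_ _ ->]]]; apply: integral_ge0 => x _.
by rewrite lee_fin addr_ge0// ?powR_ge0// sqr_ge0.
Qed.

(** The infimum may not be attained, hence the strict inequality. Disintegrating a near-optimal
    coupling over the whole first factor recovers its second marginal. *)
Lemma weak_transport_kernel (p D : R) mu mu' :
  (weak_transport p mu' mu < D%:E)%E -> exists k : R.-pker E ~> E,
  (forall B, measurable B -> mu' B = (\int[mu]_x k x B)%E) /\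
  (\int[mu]_x (wcost p ((x : 'rV[R]_d) - barycenter (k x)))%:E <= D%:E)%E.
Proof.
move=> /ereal_inf_lt [_ [pi [k [cpl dis ->]]] /ltW h]; exists k; split => // B mB.
by rewrite -(cpl B mB).2 dis.
Qed.

End Constants.

Theorem corollary2p12 (R : realType) :
  exists Bound : R -> R -> R -> R -> R -> R -> R,
  forall (d : nat) (p : R) (c : 'rV[R]_d -> R) (eps K a A : R)
    (dT : measure_display) (T : measurableType dT) (m : probability T R)
    (mu : R.-pker T ~> borel_rV R d),
  2 <= p ->
  (forall x : 'rV[R]_d, 0 <= c x) ->
  convex_function setT c ->
  0 < eps ->
  (forall x : 'rV[R]_d, eps * \1_[set z | enorm z < eps] x * enorm x ^+ 2 <= c x) ->
  (forall x : 'rV[R]_d, c x <= K * (enorm x ^+ 2 + enorm x `^ p)) ->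
  strictly_convex (conjugate c) ->
  1 < a -> a <= A ->
  (forall (x : 'rV[R]_d) (s : R), 0 <= s <= 1 ->
     (conjugate c (s *: x)%R <= (s `^ (A / (A - 1)))%:E * conjugate c x)%E) ->
  (forall (x : 'rV[R]_d) (s : R), 1 < s ->
     (conjugate c (s *: x)%R <= (s `^ (a / (a - 1)))%:E * conjugate c x)%E) ->
  let C_T := ereal_sup (range (fun t => conv_mLS_const c (mu t))) in
  let D_T := ereal_sup (range (fun tt : T * T =>
               weak_transport p (mu tt.1) (mu tt.2))) in
  (C_T < +oo)%E ->
  (D_T < +oo)%E ->
  (forall (t : T) (s : R), 0 < s -> (\int[mu t]_x (expR (s * enorm x))%:E < +oo)%E) ->
  (exists C : R, 0 < C /\ conv_mLS c (mixture m mu) C) /\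
  (conv_mLS_const c (mixture m mu) <=
     (Bound (fine C_T) (fine D_T) a A p K)%:E)%E.
Proof.
(* Adding 1 to the suprema gives strict inequalities, hence an actual log-Sobolev constant and
   actual kernels. [Num.max K 0] is a nonnegative constant that still satisfies the upper bound on
   [c]. *)
exists (fun CT DT a A p K => mixture_constant (CT + 1) (DT + 1) A (Num.max K 0)).
move=> d p c eps K a A dT T m mu p2 c_ge0 cc eps0 ceps cK _ a1 aA scA sca C_T D_T
  CTfin DTfin muexp.
(* Since 0 to the power 0 is 1, a nonzero exponent is what makes the upper bound vanish at 0 and
   gives [c 0 = 0]. *)
have p0 : p != 0 by rewrite gt_eqF// (lt_le_trans _ p2).
have c00 : c 0 = 0.
  apply: le_anti; rewrite c_ge0 andbT; apply: le_trans (cK 0) _.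
  by rewrite -(scale0r 0) enormZ normr0 mul0r powR0// expr0n addr0 mulr0.
have cj0 v : (0 <= conjugate c v)%E by exact: conjugate_ge0.
have bd := conjugate_fin c_ge0 c00 cc eps0 ceps sca.
have fin v : conjugate c v \is a fin_num.
  have [r /(_ v (lexx _)) vr] := bd (enorm v).
  by rewrite ge0_fin_numE// (le_lt_trans vr) ?ltry.
have [t0 _] := probability_inhabited m.
have CT_fin : C_T \is a fin_num.
  rewrite ge0_fin_numE//; apply: le_trans (conv_mLS_const_ge0 c (mu t0)) _.
  by apply: ereal_sup_ubound; exists t0.
have DT_fin : D_T \is a fin_num.
  rewrite ge0_fin_numE//; apply: le_trans (weak_transport_ge0 p (mu t0) (mu t0)) _.
  by apply: ereal_sup_ubound; exists (t0, t0).
have CT0 : 0 <= fine C_T.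
  apply: fine_ge0; apply: le_trans (conv_mLS_const_ge0 c (mu t0)) _.
  by apply: ereal_sup_ubound; exists t0.
have DT0 : 0 <= fine D_T.
  apply: fine_ge0; apply: le_trans (weak_transport_ge0 p (mu t0) (mu t0)) _.
  by apply: ereal_sup_ubound; exists (t0, t0).
have mLS t : conv_mLS c (mu t) (fine C_T + 1).
  apply: conv_mLS_of_const => //; apply: (@le_lt_trans _ _ C_T).
    by apply: ereal_sup_ubound; exists t.
  by rewrite -[ltLHS]fineK// lte_fin ltrDl.
have transport t t' : exists k : R.-pker borel_rV R d ~> borel_rV R d,
    (forall B, measurable B -> mu t' B = (\int[mu t]_x k x B)%E) /\
    (\int[mu t]_x (wcost p ((x : 'rV[R]_d) - barycenter (k x)))%:E <=
     (fine D_T + 1)%:E)%E.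
  apply: weak_transport_kernel; apply: (@le_lt_trans _ _ D_T).
    by apply: ereal_sup_ubound; exists (t', t).
  by rewrite -[ltLHS]fineK// lte_fin ltrDl.
have C0 : 0 < fine C_T + 1 by rewrite ltr_wpDl.
have D0 : 0 <= fine D_T + 1 by rewrite addr_ge0.
have K0 : 0 <= Num.max K 0 by rewrite le_max lexx orbT.
have A1 : 1 < A by exact: lt_le_trans aA.
have bdr M : exists r : R, forall v : 'rV[R]_d, enorm v <= M -> conjr c v <= r.
  have [r hr] := bd M; exists r => v vM.
  by rewrite -lee_fin -conjrE// hr.
have cw x : c x <= Num.max K 0 * wcost p x.
  apply: le_trans (cK x) _; rewrite ler_wpM2r ?le_max ?lexx//.
  by rewrite addr_ge0// ?powR_ge0// sqr_ge0.
have scale v (s : R) : 0 <= s <= 1 ->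
    conjr c (s *: v) <= s `^ (A / (A - 1)) * conjr c v.
  by move=> s01; apply: conjugate_scale => //; exact: scA.
have cs0 v : 0 <= conjr c v by exact: conjr_ge0.
have B0 := mixture_constant_gt0 A1 C0 D0 K0.
have B_mLS := mixture_mLS fin bdr c_ge0 cs0 p2 A1 C0 D0 K0 cw scale m muexp mLS transport.
split; first by exists (mixture_constant (fine C_T + 1) (fine D_T + 1) A (Num.max K 0)).
by apply: ereal_inf_lbound; eexists; first by split; [exact: B0|exact: B_mLS].
Qed.
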